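(* Let $(V,\omega)$ be a real symplectic vector space of dimension $2n$. If $n\ge 2$, the space of cotorsion-like tensors $S^2V^*\otimes V^*$ has the (direct sum) decomposition into irreducible $\mathrm{Sp}(V)$-submodules $$S^2V^*\otimes V^*=\mathcal S_1(V)+\mathcal S_2(V)+\mathcal S_3(V),$$ where $$\mathcal S_1(V)=\{S\in S^2V^*\otimes V^*: S_{XYZ}=\omega_{ZY}\omega_{XU}+\omega_{ZX}\omega_{YU}\ \text{for some } U\in V\},$$ $$\mathcal S_2(V)=\{S\in S^2V^*\otimes V^*: S_{XYZ}+S_{YZX}+S_{ZXY}=0,\ \mathrm s_{13}(S)=0\},$$ $$\mathcal S_3(V)=\{S\in S^2V^*\otimes V^*: S_{XYZ}=S_{XZY}\}=S^3V^*,$$ and $$\mathrm s_{13}(S)(Z)=\sum_{i=1}^n\left(S_{e_iZe_{i+n}}-S_{e_{i+n}Ze_i}\right)$$ for a symplectic basis $\{e_1,\dots,e_n,e_{n+1},\dots,e_{2n}\}$ of $V$. If $n=1$, then $S^2V^*\otimes V^*=\mathcal S_1(V)+\mathcal S_3(V)$. The dimensions of the subspaces are $$\dim\mathcal S_1(V)=2n,\qquad \dim\mathcal S_2(V)=\tfrac83(n^3-n),\qquad\dim\mathcal S_3(V)=\binom{2n+2}{3}.$$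
   Context: $\omega_{XY}=\omega(X,Y)$. A tensor $S\in S^2V^*\otimes V^*$ is a trilinear form $S_{XYZ}=S(X,Y,Z)$ on $V$ with $S_{XYZ}=S_{YXZ}$. Conditions on $S_{XYZ}$ are to hold for all $X,Y,Z\in V$. A symplectic basis satisfies $\omega(e_i,e_{j+n})=\delta_{ij}$, $\omega(e_i,e_j)=\omega(e_{i+n},e_{j+n})=0$ for $1\le i,j\le n$. $\mathrm{Sp}(V)=\mathrm{Sp}(V,\omega)$ acts naturally on tensors. *)

(* Defs.v *)
From HB Require Import structures.
From mathcomp Require Import all_boot all_order all_algebra.
From mathcomp Require Import perm reals.

Set Implicit Arguments.
Unset Strict Implicit.
Unset Printing Implicit Defensive.

Import GRing.Theory.
Local Open Scope ring_scope.

(* V* (x) V* (x) V* as the space of curried trilinear forms, so that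
   S_{XYZ} is [S X Y Z]. *)
Notation trilinear R V := 'Hom(V, 'Hom(V, 'Hom(V, R^o))).

Section Tensors.
Variables (R : realType) (V : vectType R).
Implicit Types (w : {skew_symmetric V}) (g : 'End(V)) (S : trilinear R V).
Implicit Types (X Y Z : V) (W : {vspace trilinear R V}).

Definition cotorsion_like S := forall X Y Z, S X Y Z = S Y X Z.

(* Preservation of w already makes g injective when w is nondegenerate. *)
Definition Sp w g := lker g = 0%VS /\ forall X Y, w (g X) (g Y) = w X Y.

Definition tensor_act g S : trilinear R V :=
  linfun (fun X => linfun (fun Y => S (g^-1%VF X) (g^-1%VF Y) \o g^-1)%VF).

Lemma tensor_actE g S X Y Z :
  tensor_act g S X Y Z = S (g^-1%VF X) (g^-1%VF Y) (g^-1%VF Z).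
Proof.
pose f X Y := (S (g^-1%VF X) (g^-1%VF Y) \o g^-1)%VF.
have f_lin X' : linear (f X').
  move=> a u v; apply/lfunP=> z.
  by rewrite /f !(linearP, comp_lfunE, add_lfunE, scale_lfunE).
pose f_linM X' := GRing.isLinear.Build _ _ _ _ (f X') (f_lin X').
pose fL X' : {linear V -> 'Hom(V, R^o)} := HB.pack (f X') (f_linM X').
have fE X' Y' : linfun (f X') Y' = f X' Y' by rewrite (lfunE (fL X')).
have h_lin : linear (fun X => linfun (f X)).
  move=> a u v; apply/lfunP=> y; rewrite !(add_lfunE, scale_lfunE) !fE.
  apply/lfunP=> z.
  by rewrite /f !(linearP, comp_lfunE, add_lfunE, scale_lfunE).
pose h_linM := GRing.isLinear.Build _ _ _ _ (fun X => linfun (f X)) h_lin.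
pose hL : {linear V -> 'Hom(V, 'Hom(V, R^o))} :=
  HB.pack (fun X => linfun (f X)) h_linM.
by rewrite /tensor_act (lfunE hL) /= fE comp_lfunE.
Qed.

Definition Sp_submodule w W :=
  forall g S, Sp w g -> S \in W -> tensor_act g S \in W.

Definition irreducible_Sp_submodule w W :=
  [/\ Sp_submodule w W, W <> 0%VS
    & forall U, Sp_submodule w U -> (U <= W)%VS -> U = 0%VS \/ U = W].

(* The vectors e_i and e_(i+n) of a symplectic basis are the components of index [lshift n i] and
   [rshift n i], for i : 'I_n. *)
Definition symplectic_basis w n (e : (n + n).-tuple V) :=
  basis_of {:V} e /\
  forall i j : 'I_n,
    [/\ w (tnth e (lshift n i)) (tnth e (rshift n j)) = (i == j)%:R,
        w (tnth e (lshift n i)) (tnth e (lshift n j)) = 0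
      & w (tnth e (rshift n i)) (tnth e (rshift n j)) = 0].

Definition s13 n (e : (n + n).-tuple V) S Z : R :=
  \sum_(i < n) (S (tnth e (lshift n i)) Z (tnth e (rshift n i))
                - S (tnth e (rshift n i)) Z (tnth e (lshift n i))).

Definition in_S1 w S := cotorsion_like S /\
  exists U : V, forall X Y Z, S X Y Z = w Z Y * w X U + w Z X * w Y U.

Definition in_S2 n (e : (n + n).-tuple V) S :=
  [/\ cotorsion_like S,
      forall X Y Z, S X Y Z + S Y Z X + S Z X Y = 0
    & forall Z, s13 e S Z = 0].

Definition in_S3 S :=
  cotorsion_like S /\ forall X Y Z, S X Y Z = S X Z Y.

Definition totally_symmetric S :=
  forall (s : 'S_3) (x : 'I_3 -> V),
    S (x (s 0)) (x (s 1)) (x (s 2)) = S (x 0) (x 1) (x 2).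

Definition hyperbolic w k (p q : nat -> V) :=
  forall i j, (i < k)%N -> (j < k)%N ->
    [/\ w (p i) (q j) = (i == j)%:R, w (p i) (p j) = 0 & w (q i) (q j) = 0].

Lemma skewC w X Y : w X Y = - w Y X.
Proof. by rewrite (hermC w) expr1 mulN1r. Qed.

Lemma skew_diag w X : w X X = 0.
Proof.
apply/eqP; have: w X X *+ 2 == 0 by rewrite mulr2n {2}skewC addrN.
by rewrite Num.Theory.mulrn_eq0.
Qed.

Lemma hyperbolic_proj w k p q : hyperbolic w k p q -> forall X,
  exists2 Y, X - Y \in <<mkseq p k ++ mkseq q k>>%VS &
  forall i, (i < k)%N -> w (p i) Y = 0 /\ w (q i) Y = 0.
Proof.
move=> hyp X.
pose c := \sum_(j < k) (w (p j) X *: q j - w (q j) X *: p j).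
exists (X - c).
  rewrite opprB addrC subrK; apply: memv_suml => j _.
  apply: memvB; apply: memvZ; apply: memv_span; rewrite mem_cat.
    by rewrite [_ \in mkseq q k]map_f ?orbT // mem_iota ltn_ord.
  by rewrite [_ \in mkseq p k]map_f // mem_iota ltn_ord.
move=> i ik; rewrite !linearBr !linear_sumr /=; split.
- rewrite (bigD1 (Ordinal ik)) //= big1 ?addr0 => [|j ji].
    have [pq pp _] := hyp i i ik ik.
    by rewrite linearBr !linearZr_LR /= pq pp eqxx mulr1 mulr0 subr0 subrr.
  have [pq pp _] := hyp i j ik (ltn_ord j).
  have /negbTE ij : i != j by rewrite eq_sym; move: ji; rewrite -val_eqE.
  by rewrite linearBr !linearZr_LR /= pq pp ij !mulr0 subr0.
rewrite (bigD1 (Ordinal ik)) //= big1 ?addr0 => [|j ji].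
  have [pq _ qq] := hyp i i ik ik.
  rewrite linearBr !linearZr_LR /= qq (skewC w (q i) (p i)) pq eqxx.
  by rewrite mulr0 mulrN1 sub0r opprK subrr.
have [_ _ qq] := hyp i j ik (ltn_ord j).
have [qp _ _] := hyp j i (ltn_ord j) ik.
have /negbTE ij : (j : nat) != i by move: ji; rewrite -val_eqE.
by rewrite linearBr !linearZr_LR /= qq (skewC w (q i) (p j)) qp ij oppr0 !mulr0 subr0.
Qed.

Lemma hyperbolic_ext w k p q : is_psymplectic w -> hyperbolic w k p q ->
  (k + k < \dim {:V})%N -> exists p' q', hyperbolic w k.+1 p' q'.
Proof.
move=> [ndw _ _] hyp kV; set U := <<mkseq p k ++ mkseq q k>>%VS.
have /subvPn [x _ xU] : ~~ ({:V} <= U)%VS.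
  apply: contraL kV => /dimvS VU; rewrite -leqNgt (leq_trans VU) //.
  by rewrite (leq_trans (dim_span _)) // size_cat !size_mkseq.
have [u xu u_orth] := hyperbolic_proj hyp x.
have u0 : u != 0 by apply: contraNneq xU => u0; rewrite u0 subr0 in xu.
have /mem_orthovPn [y _ uy] : u \notin orthov w {:V}.
  by rewrite (eqP ndw) memv0.
have [v yv v_orth] := hyperbolic_proj hyp y.
have u_ortho_U z : z \in U -> w u z = 0.
  have : (U <= orthov w <[u]>)%VS.
    apply/span_subvP => z' /=; rewrite mem_cat mem_orthov1 => /orP[] /mapP[i]; rewrite mem_iota add0n => /= ik ->.
      by rewrite (u_orth i ik).1.
    by rewrite (u_orth i ik).2.
  move=> /subvP + zU => /(_ _ zU); rewrite mem_orthov1 => /eqP zu.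
  by rewrite skewC zu oppr0.
have uv : w u v != 0.
  by apply: contraNneq uy => uv; rewrite -(subrK v y) linearDr /= u_ortho_U // uv addr0.
exists (fun i => if i == k then u else p i).
exists (fun i => if i == k then (w u v)^-1 *: v else q i).
move=> i j; rewrite !ltnS (leq_eqVlt i) (leq_eqVlt j).
case: (eqVneq i k) => [-> _|ik /= ltik]; case: (eqVneq j k) => [-> _|jk /= ltjk].
- by rewrite !linearZr_LR !linearZl_LR /= mulVf // !skew_diag !mulr0.
- have [pu qu] := u_orth j ltjk; have [pv qv] := v_orth j ltjk.
  rewrite linearZl_LR /= (skewC w u (q j)) (skewC w u (p j)) (skewC w v) pu qu qv.
  by rewrite oppr0 mulr0.
- have [pu qu] := u_orth i ltik; have [pv qv] := v_orth i ltik.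
  by rewrite !linearZr_LR /= pu pv qv (negbTE ik) !mulr0.
exact: hyp.
Qed.

(* A condition imposed for every symplectic basis is thus not void. *)
Lemma symplectic_basis_exists w n : \dim {:V} = (2 * n)%N ->
  is_psymplectic w -> exists e : (n + n).-tuple V, symplectic_basis w e.
Proof.
rewrite mul2n -addnn => dimV ww.
have ext k : (k <= n)%N -> exists p q, hyperbolic w k p q.
  elim: k => [_|k IHk kn]; first by exists (fun=> 0), (fun=> 0).
  have [p [q hyp]] := IHk (ltnW kn).
  apply: hyperbolic_ext hyp _ => //.
  by rewrite dimV -addnS leq_add // ltnW.
have [p [q hyp]] := ext n (leqnn n).
pose f (i : 'I_(n + n)) :=
  match split i with inl j => p j | inr j => q j end.
pose e := [tuple f i | i < n + n]; exists e.
have el j : tnth e (lshift n j) = p j.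
  by rewrite tnth_mktuple /f (unsplitK (inl j)).
have er j : tnth e (rshift n j) = q j.
  by rewrite tnth_mktuple /f (unsplitK (inr j)).
split; last first.
  by move=> i j; rewrite !el !er; apply: (hyp i j).
rewrite basisEfree subvf size_tuple dimV leqnn !andbT.
move: e el er => e el er; apply/freeP => c; rewrite big_split_ord /=.
under eq_bigr => i _ do rewrite -[_`_i](tnth_nth 0 e (lshift n i)) el.
under [X in _ + X]eq_bigr => i _ do rewrite -[_`_(n + i)](tnth_nth 0 e (rshift n i)) er.
move=> c0 i; rewrite -(splitK i).
have coef (g : V -> R) : linear_for *%R g ->
  \sum_(j < n) c (lshift n j) * g (p j)
  + \sum_(j < n) c (rshift n j) * g (q j) = 0.
  move=> glin; pose gM := GRing.isLinear.Build _ _ _ _ g glin.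
  pose gL : {linear V -> R | *%R} := HB.pack g gM.
  have := congr1 gL c0; rewrite linear0 linearD !linear_sum.
  under eq_bigr do rewrite (linearZ_LR gL).
  by under [X in _ + X = _ -> _]eq_bigr do rewrite (linearZ_LR gL).
case: (split i) => j /=.
  have := coef (w^~ (q j)) (linearPl w (q j)).
  rewrite [X in _ + X]big1 ?addr0 => [|l _]; last first.
    by have [_ _ ->] := hyp _ _ (ltn_ord l) (ltn_ord j); rewrite mulr0.
  rewrite (bigD1 j) //= big1 ?addr0 => [|l /negbTE lj]; last first.
    by have [-> _ _] := hyp _ _ (ltn_ord l) (ltn_ord j); rewrite (lj : (l == j :> nat) = false) mulr0.
  by have [-> _ _] := hyp _ _ (ltn_ord j) (ltn_ord j); rewrite eqxx mulr1.
have := coef (w (p j)) (linearPr w (p j)).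
rewrite big1 ?add0r => [|l _]; last first.
  by have [_ -> _] := hyp _ _ (ltn_ord j) (ltn_ord l); rewrite mulr0.
rewrite (bigD1 j) //= big1 ?addr0 => [|l /negbTE lj]; last first.
  by have [-> _ _] := hyp _ _ (ltn_ord j) (ltn_ord l); rewrite eq_sym (lj : (l == j :> nat) = false) mulr0.
by have [-> _ _] := hyp _ _ (ltn_ord j) (ltn_ord j); rewrite eqxx mulr1.
Qed.

End Tensors.

(* Main.v *)
Require Import Defs.
From HB Require Import structures.
From mathcomp Require Import all_boot all_order all_algebra.
From mathcomp Require Import perm boolp reals zify ring lra.

Set Implicit Arguments.
Unset Strict Implicit.
Unset Printing Implicit Defensive.

Import GRing.Theory Num.Theory.
Local Open Scope ring_scope.

(** Sp(V) contains the transvections T_{v,t} : X |-> X + t w(v,X) v, and it is transitive on nonzero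
vectors.  The action of T_{v,t} on a tensor S is polynomial in t, so a submodule containing S
contains its coefficients.  If S is symmetric, the cubic one is a multiple of the cube of w(v,.),
with factor S(v,v,v); if the cyclic sum of S vanishes, the quadratic one is the hook tensor
2 aab - aba - baa of v and b, where w(b,.) = S(v,v,.).  By transitivity, a nonzero submodule of S_3
contains all cubes; and one of S_2 contains all hook tensors of orthogonal pairs, as S(v,v,Z) = 0
whenever w(v,Z) = 0 forces a trace-free S to vanish.

These tensors span: under the pairing of tensors induced by w, the cube of v pairs with S to
S(v,v,v), and the hook tensor of (a,b) to a multiple of S(a,a,b).  So no nonzero S is orthogonal to
all of them, which bounds the dimension of the module by that of the submodule.

The decomposition itself is explicit: the cyclic sum kills S_1 and S_2 and is 3 on S_3, and the
trace s13 of the element of S_1 given by U is -(2n+1) w(.,U).  The dimensions of S^2 V* (x) V* and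
S_3 are counted on sorted index tuples, that of S_2 is the difference. *)

(** * Subspaces and dimension counts *)

(** As long as P holds for some vector outside U, that vector enlarges U within P; the codimension
    bounds the number of such steps. *)
Lemma vspace_of_closed (R : fieldType) (T : vectType R) (P : T -> Prop) :
  P 0 -> (forall a x y, P x -> P y -> P (a *: x + y)) ->
  exists W : {vspace T}, forall x, x \in W <-> P x.
Proof.
move=> P0 Plin.
suff ext k (U : {vspace T}) : (forall x, x \in U -> P x) ->
    (\dim {:T} - \dim U <= k)%N -> exists W : {vspace T}, forall x, x \in W <-> P x.
  by apply: (ext (\dim {:T}) 0%VS); [move=> x; rewrite memv0 => /eqP-> | exact: leq_subr].
elim: k U => [|k IHk] U UP kU.
  exists U => x; split; first exact: UP.
  suff /eqP-> : U == {:T}%VS by rewrite memvf.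
  by rewrite eqEdim subvf -subn_eq0 -leqn0.
have [[x Px xU]|UW] := pselect (exists2 x, P x & x \notin U); last first.
  exists U => x; split; first exact: UP.
  by move=> Px; apply: contrapT => /negP xU; apply: UW; exists x.
apply: (IHk (<[x]> + U)%VS) => [y|].
  case/memv_addP => _ /vlineP[a ->] [z zU ->].
  by apply: Plin => //; exact: UP.
have : (\dim U < \dim (<[x]> + U))%N.
  rewrite ltnNge; apply: contra xU => dimU.
  have /eqP-> : U == (<[x]> + U)%VS by rewrite eqEdim addvSr.
  by apply: subvP (memv_line x); exact: addvSl.
by move: kU (dimvS (subvf (<[x]> + U)%VS)); lia.
Qed.

Definition lincomb (F : fieldType) (T : vectType F) (r : seq (F * T)) : T :=
  \sum_(p <- r) p.1 *: p.2.

Lemma memv_lincomb (F : fieldType) (T : vectType F) (U : {vspace T}) (r : seq (F * T)) :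
  (forall p, p \in r -> p.2 \in U) -> lincomb r \in U.
Proof. by move=> rU; rewrite /lincomb big_seq; apply: memv_suml => p /rU; exact: memvZ. Qed.

(** Pairing with a basis of U maps W linearly to rows of length [\dim U]; separation makes this map
    injective on W. *)
Lemma dimv_le_separated (F : fieldType) (T T' : vectType F)
    (W : {vspace T}) (U : {vspace T'}) (beta : T -> T' -> F) :
  (forall u, linear_for *%R (beta^~ u)) -> (forall x, linear_for *%R (beta x)) ->
  (forall x, x \in W -> (forall u, u \in U -> beta x u = 0) -> x = 0) ->
  (\dim W <= \dim U)%N.
Proof.
move=> beta1 beta2 sep.
pose f x : 'rV[F]_(\dim U) := \row_i beta x (vbasis U)`_i.
have f_lin : linear f.
  by move=> a x y; apply/rowP => i; rewrite !mxE; exact: beta1.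
pose fM := GRing.isLinear.Build _ _ _ _ f f_lin.
pose fL : {linear T -> 'rV[F]_(\dim U)} := HB.pack f fM.
have /limg_dim_eq <- : (W :&: lker (linfun fL) = 0)%VS; last first.
  by rewrite (leq_trans (dimvS (subvf _))) // dimvf dim_matrix mul1r.
apply/eqP; rewrite -subv0; apply/subvP => x /memv_capP[xW].
rewrite memv_ker lfunE memv0 /= => /eqP fx; apply/eqP/sep => // u uU.
pose gM := GRing.isLinear.Build _ _ _ _ (beta x : T' -> F^o) (beta2 x).
pose gL : {linear T' -> F^o} := HB.pack (beta x : T' -> F^o) gM.
rewrite -[beta x u]/(gL u) (coord_vbasis uU) linear_sum big1 // => i _.
rewrite linearZ /=; have := congr1 (fun r : 'rV__ => r 0 i) fx.
by rewrite !mxE => ->; rewrite scaler0.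
Qed.

Lemma subv_eq0_or_nonzero (F : fieldType) (T : vectType F) (U : {vspace T}) :
  U = 0%VS \/ exists2 x, x \in U & x <> 0.
Proof.
have [->|U0] := eqVneq U 0%VS; [by left | right; exists (vpick U)].
  exact: memv_pick.
by apply/eqP; rewrite vpick0.
Qed.

Lemma vspace_anti (F : fieldType) (T : vectType F) (U W : {vspace T}) :
  (U <= W)%VS -> (forall x, x \in W -> x \in U) -> U = W.
Proof. by move=> UW WU; apply/eqP; rewrite eqEsubv UW; apply/subvP. Qed.

(** The values at the points of A are coordinates on W: the second hypothesis is injectivity, the
    third provides the dual basis. *)
Lemma dimv_of_coords (F : fieldType) (T : vectType F) (W : {vspace T})
    (X : finType) (A : {set X}) (ev : T -> X -> F) :
  (forall x, linear_for *%R (ev^~ x)) ->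
  (forall S, S \in W -> (forall x, x \in A -> ev S x = 0) -> S = 0) ->
  (forall x, x \in A -> exists2 S, S \in W & forall y, y \in A -> ev S y = (x == y)%:R) ->
  \dim W = #|A|.
Proof.
move=> ev_lin ev_inj ev_surj.
pose f S : 'rV[F]_#|A| := \row_i ev S (enum_val i).
have f_lin : linear f by move=> a x y; apply/rowP => i; rewrite !mxE; exact: ev_lin.
pose fM := GRing.isLinear.Build _ _ _ _ f f_lin.
pose fL : {linear T -> 'rV[F]_#|A|} := HB.pack f fM.
have /limg_dim_eq <- : (W :&: lker (linfun fL) = 0)%VS.
  apply/eqP; rewrite -subv0; apply/subvP => S /memv_capP[SW].
  rewrite memv_ker lfunE memv0 /= => /eqP fS; apply/eqP/ev_inj => // x xA.
  have := congr1 (fun r : 'rV__ => r 0 (enum_rank_in xA x)) fS.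
  by rewrite !mxE enum_rankK_in.
suff -> : (linfun fL @: W)%VS = fullv by rewrite dimvf dim_matrix mul1r.
apply/eqP; rewrite eqEsubv subvf; apply/subvP => v _.
rewrite (row_sum_delta v); apply: memv_suml => i _; apply: memvZ.
have [S SW Si] := ev_surj _ (enum_valP i).
apply/memv_imgP; exists S => //; apply/rowP => j; rewrite lfunE !mxE eqxx /=.
by rewrite Si ?enum_valP // (inj_eq enum_val_inj) eq_sym.
Qed.

(** The idempotent r picks a representative of each class of indices, and W consists of the vectors
    whose coordinates are constant on classes; the coordinates at the fixed points of r are then
    free. *)
Lemma dimv_of_orbits (F : fieldType) (T : vectType F) (W : {vspace T})
    (X : finType) (r : X -> X) (ev : T -> X -> F) :
  (forall x, linear_for *%R (ev^~ x)) -> (forall x, r (r x) = r x) ->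
  (forall S, (forall x, ev S x = 0) -> S = 0) ->
  (forall f, exists S, forall x, ev S x = f x) ->
  (forall S, S \in W <-> forall x, ev S (r x) = ev S x) ->
  \dim W = #|[set x | r x == x]|.
Proof.
move=> ev_lin rr ev_inj ev_surj WP; apply: (dimv_of_coords (ev := ev)) => //.
  move=> S /WP Sr S0; apply: ev_inj => x; rewrite -Sr; apply: S0.
  by rewrite inE rr.
move=> x; rewrite inE => /eqP rx; have [S SE] := ev_surj (fun y => (x == r y)%:R).
exists S => [|y]; first by apply/WP => y; rewrite !SE rr.
by rewrite inE SE => /eqP->.
Qed.

(** * Sorted tuples as multisets of indices *)

Definition sort_ord m k (t : k.-tuple 'I_m) : k.-tuple 'I_m :=
  [tuple of sort (relpre val leq) t].

Lemma sort_ord_id m k (t : k.-tuple 'I_m) : (sort_ord t == t) = sorted leq (map val t).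
Proof.
rewrite sorted_map; apply/eqP/idP => [<-|st].
  by apply: sort_sorted => x y; exact: leq_total.
by apply: val_inj; apply: sorted_sort => // y x z; exact: leq_trans.
Qed.

Lemma perm_sort_ord m k (t : k.-tuple 'I_m) : perm_eq (sort_ord t) t.
Proof. exact: permEl (perm_sort _ _). Qed.

Lemma sort_ord_perm m k (t t' : k.-tuple 'I_m) : perm_eq t t' -> sort_ord t = sort_ord t'.
Proof.
move=> tt'; apply: val_inj; apply/perm_sortP => //.
- by move=> x y; exact: leq_total.
- by move=> y x z; exact: leq_trans.
- by move=> x y; rewrite -eqn_leq => /eqP/val_inj.
Qed.

Lemma sort_ord_idem m k (t : k.-tuple 'I_m) : sort_ord (sort_ord t) = sort_ord t.
Proof. exact: sort_ord_perm (perm_sort_ord t). Qed.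

Lemma card_sort_ord m k : (0 < k)%N ->
  #|[set t : k.-tuple 'I_m | sort_ord t == t]| = 'C((k + m).-1, k).
Proof.
move=> k0; under eq_finset do rewrite sort_ord_id.
(* For m = 0 there is no tuple of positive length, and C(k-1, k) = 0 as well. *)
case: m => [|m]; last by rewrite card_sorted_tuples addnS.
rewrite addn0 bin_small ?prednK //.
by apply: eq_card0; case: k k0 => // k _; case/tupleP => [[]].
Qed.

(** * Trilinear forms *)

(* Instance inference and conversion become very slow on iterated ['Hom]; behind the constant
   [hom_space] they do not look into it. *)
Definition hom_space (F : fieldType) (A B : vectType F) : vectType F := 'Hom(A, B).
Arguments hom_space : simpl never.

Section Hom.
Variables (F : fieldType) (A B : vectType F).

Definition happ (f : hom_space A B) (x : A) : B := (f : 'Hom(A, B)) x.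
Arguments happ : simpl never.

Lemma happP (f g : hom_space A B) : happ f =1 happ g -> f = g.
Proof. by move=> fg; apply/lfunP. Qed.
Lemma happDl (f g : hom_space A B) x : happ (f + g) x = happ f x + happ g x.
Proof. exact: add_lfunE. Qed.
Lemma happZl a (f : hom_space A B) x : happ (a *: f) x = a *: happ f x.
Proof. exact: scale_lfunE. Qed.
Lemma happDr (f : hom_space A B) x y : happ f (x + y) = happ f x + happ f y.
Proof. by rewrite /happ linearD. Qed.
Lemma happZr (f : hom_space A B) a x : happ f (a *: x) = a *: happ f x.
Proof. by rewrite /happ linearZ. Qed.

Definition hom_of (f : A -> B) : hom_space A B := linfun f.
Lemma hom_ofE f x : linear f -> happ (hom_of f) x = f x.
Proof.
move=> f_lin; pose fM := GRing.isLinear.Build _ _ _ _ f f_lin.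
pose fL : {linear A -> B} := HB.pack f fM.
exact: (lfunE fL).
Qed.
End Hom.

Definition tensor (R : realType) (V : vectType R) : vectType R :=
  hom_space V (hom_space V (hom_space V (R^o : vectType R))).
Arguments tensor : simpl never.

Definition tensor_eval (R : realType) (V : vectType R) (S : tensor V) (X Y Z : V) : R :=
  happ (happ (happ S X) Y) Z.
Arguments tensor_eval : simpl never.
Coercion tensor_eval : Vector.sort >-> Funclass.

Section Tensors.
Variables (R : realType) (V : vectType R) (w : {skew_symmetric V}).
Implicit Types (S : tensor V) (X Y Z : V) (g : 'End(V)).

Lemma wD1 X X' Y : w (X + X') Y = w X Y + w X' Y. Proof. exact: linearDl. Qed.
Lemma wD2 X Y Y' : w X (Y + Y') = w X Y + w X Y'. Proof. exact: linearDr. Qed.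
Lemma wZ1 a X Y : w (a *: X) Y = a * w X Y. Proof. exact: linearZl_LR. Qed.
Lemma wZ2 a X Y : w X (a *: Y) = a * w X Y. Proof. exact: linearZr_LR. Qed.
Lemma wN1 X Y : w (- X) Y = - w X Y. Proof. exact: linearNl. Qed.
Lemma wN2 X Y : w X (- Y) = - w X Y. Proof. exact: linearNr. Qed.
Lemma w01 Y : w 0 Y = 0. Proof. exact: linear0l. Qed.
Lemma w02 X : w X 0 = 0. Proof. exact: linear0r. Qed.
Lemma w_sum1 I (r : seq I) P (F : I -> V) Y :
  w (\sum_(i <- r | P i) F i) Y = \sum_(i <- r | P i) w (F i) Y.
Proof. exact: (big_morph (w^~ Y) (fun x y => wD1 x y Y) (w01 Y)). Qed.
Lemma w_sum2 I (r : seq I) P (F : I -> V) X :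
  w X (\sum_(i <- r | P i) F i) = \sum_(i <- r | P i) w X (F i).
Proof. exact: linear_sumr. Qed.
Definition wE := (wD1, wD2, wZ1, wZ2, wN1, wN2, w01, w02).

Lemma triP S S' : (forall X Y Z, S X Y Z = S' X Y Z) <-> S = S'.
Proof.
split=> [SS'|-> //].
by apply: happP => X; apply: happP => Y; apply: happP => Z; exact: SS'.
Qed.

Lemma tri_add S S' X Y Z : (S + S' : tensor V) X Y Z = S X Y Z + S' X Y Z :> R.
Proof. by rewrite /tensor_eval !happDl. Qed.
Lemma tri_scale a S X Y Z : (a *: S : tensor V) X Y Z = a * S X Y Z :> R.
Proof. by rewrite /tensor_eval !happZl. Qed.
Lemma tri_zero X Y Z : (0 : tensor V) X Y Z = 0 :> R.
Proof. by rewrite -(scale0r 0) tri_scale mul0r. Qed.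

Lemma triD1 S X X' Y Z : S (X + X') Y Z = S X Y Z + S X' Y Z :> R.
Proof. by rewrite /tensor_eval happDr !happDl. Qed.
Lemma triD2 S X Y Y' Z : S X (Y + Y') Z = S X Y Z + S X Y' Z :> R.
Proof. by rewrite /tensor_eval happDr happDl. Qed.
Lemma triD3 S X Y Z Z' : S X Y (Z + Z') = S X Y Z + S X Y Z' :> R.
Proof. by rewrite /tensor_eval happDr. Qed.
Lemma triZ1 S a X Y Z : S (a *: X) Y Z = a * S X Y Z :> R.
Proof. by rewrite /tensor_eval happZr !happZl. Qed.
Lemma triZ2 S a X Y Z : S X (a *: Y) Z = a * S X Y Z :> R.
Proof. by rewrite /tensor_eval happZr happZl. Qed.
Lemma triZ3 S a X Y Z : S X Y (a *: Z) = a * S X Y Z :> R.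
Proof. by rewrite /tensor_eval happZr. Qed.
Lemma triN1 S X Y Z : S (- X) Y Z = - S X Y Z :> R.
Proof. by rewrite -scaleN1r triZ1 mulN1r. Qed.
Lemma triN2 S X Y Z : S X (- Y) Z = - S X Y Z :> R.
Proof. by rewrite -scaleN1r triZ2 mulN1r. Qed.
Lemma triN3 S X Y Z : S X Y (- Z) = - S X Y Z :> R.
Proof. by rewrite -scaleN1r triZ3 mulN1r. Qed.
Lemma tri01 S Y Z : S 0 Y Z = 0 :> R.
Proof. by rewrite -(scale0r 0) triZ1 mul0r. Qed.
Lemma tri02 S X Z : S X 0 Z = 0 :> R.
Proof. by rewrite -(scale0r 0) triZ2 mul0r. Qed.
Lemma tri03 S X Y : S X Y 0 = 0 :> R.
Proof. by rewrite -(scale0r 0) triZ3 mul0r. Qed.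
Definition triE := (triD1, triD2, triD3, triZ1, triZ2, triZ3, triN1, triN2, triN3).

Lemma tri_sum1 S I (r : seq I) P (F : I -> V) Y Z :
  S (\sum_(i <- r | P i) F i) Y Z = \sum_(i <- r | P i) S (F i) Y Z :> R.
Proof. exact: (big_morph (fun x => S x Y Z : R) (fun x y => triD1 S x y Y Z) (tri01 S Y Z)). Qed.
Lemma tri_sum2 S I (r : seq I) P (F : I -> V) X Z :
  S X (\sum_(i <- r | P i) F i) Z = \sum_(i <- r | P i) S X (F i) Z :> R.
Proof. exact: (big_morph (fun y => S X y Z : R) (fun x y => triD2 S X x y Z) (tri02 S X Z)). Qed.
Lemma tri_sum3 S I (r : seq I) P (F : I -> V) X Y :
  S X Y (\sum_(i <- r | P i) F i) = \sum_(i <- r | P i) S X Y (F i) :> R.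
Proof. exact: (big_morph (fun z => S X Y z : R) (fun x y => triD3 S X Y x y) (tri03 S X Y)). Qed.
Lemma tri_sum I (r : seq I) P (F : I -> tensor V) X Y Z :
  (\sum_(i <- r | P i) F i : tensor V) X Y Z = \sum_(i <- r | P i) F i X Y Z :> R.
Proof.
exact: (big_morph (fun S : tensor V => S X Y Z : R)
  (fun S S' => tri_add S S' X Y Z) (tri_zero X Y Z)).
Qed.

Definition trilin (f : V -> V -> V -> R) :=
  [/\ forall X Y, linear_for *%R (f X Y), forall X Z, linear_for *%R (fun Y => f X Y Z)
    & forall Y Z, linear_for *%R (fun X => f X Y Z)].

(** Meant for trilinear f only: [linfun] of a map that is not linear need not have the values of
    that map. *)
Definition tri_of (f : V -> V -> V -> R) : tensor V :=
  hom_of (fun X => hom_of (fun Y => hom_of (fun Z => f X Y Z : R^o))).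

Lemma tri_ofE f X Y Z : trilin f -> tri_of f X Y Z = f X Y Z :> R.
Proof.
move=> [f3 f2 f1]; rewrite /tensor_eval.
have E3 A B C : happ (hom_of (fun Z => f A B Z : R^o)) C = f A B C.
  by rewrite hom_ofE //; exact: f3.
have E2 A B C : happ (happ (hom_of (fun Y => hom_of (fun Z => f A Y Z : R^o))) B) C = f A B C.
  rewrite hom_ofE // => a x y; apply: happP => z.
  by rewrite happDl happZl !E3; exact: f2.
rewrite hom_ofE // => a x y; apply: happP => y'; apply: happP => z.
by rewrite !(happDl, happZl) !E2; exact: f1.
Qed.

Definition tens (a b c : V) := tri_of (fun X Y Z => w a X * w b Y * w c Z).
Lemma tensE a b c X Y Z : tens a b c X Y Z = w a X * w b Y * w c Z :> R.
Proof. by rewrite tri_ofE //; split=> ? ? ? ? ? /=; rewrite !wE; ring. Qed.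

Definition vec_tensor (U : V) := tri_of (fun X Y Z => w Z Y * w X U + w Z X * w Y U).
Lemma vec_tensorE U X Y Z : vec_tensor U X Y Z = w Z Y * w X U + w Z X * w Y U :> R.
Proof. by rewrite tri_ofE //; split=> ? ? ? ? ? /=; rewrite !wE; ring. Qed.

(** Up to scale, the projection of aab to the Young symmetry type (2,1). Its trace over a dual pair
    is 3 w(a,b) w(a,.), so it lies in S_2 when w(a,b) = 0. *)
Definition hook a b := tri_of (fun X Y Z =>
  2 * (w a X * w a Y * w b Z) - w a X * w b Y * w a Z - w b X * w a Y * w a Z).
Lemma hookE a b X Y Z : hook a b X Y Z =
  2 * (w a X * w a Y * w b Z) - w a X * w b Y * w a Z - w b X * w a Y * w a Z :> R.
Proof. by rewrite tri_ofE //; split=> ? ? ? ? ? /=; rewrite !wE; ring. Qed.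

(** * Transvections and the action of Sp(V) *)

Definition transvection_fun (v : V) (t : R) X := X + (t * w v X) *: v.
Definition transvection v t : 'End(V) := linfun (transvection_fun v t).
Lemma transvectionE v t X : transvection v t X = X + (t * w v X) *: v.
Proof.
have lin : linear (transvection_fun v t).
  move=> a x y; rewrite /transvection_fun !wE !mulrDr scalerDr scalerDl scalerA.
  by rewrite mulrCA addrACA.
pose M := GRing.isLinear.Build _ _ _ _ _ lin.
pose L : {linear V -> V} := HB.pack (transvection_fun v t) M.
by rewrite /transvection (lfunE L).
Qed.

Lemma transvectionK v t : cancel (transvection v t) (transvection v (- t)).
Proof.
move=> X; rewrite !transvectionE !wE skew_diag !mulr0 addr0.
by rewrite -addrA -scalerDl mulNr subrr scale0r addr0.
Qed.

Lemma Sp_transvection v t : Sp w (transvection v t).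
Proof.
split.
  by apply/eqP/lker0P; exact: can_inj (transvectionK v t).
by move=> X Y; rewrite !transvectionE !wE skew_diag (skewC w X v); ring.
Qed.

Lemma transvectionV v t X : (transvection v t)^-1%VF X = transvection v (- t) X.
Proof.
have [/eqP ker _] := Sp_transvection v t.
apply: (can_inj (lker0_lfunK ker)); rewrite lker0_lfunVK //.
by have := transvectionK v (- t) X; rewrite opprK => ->.
Qed.

(** The inverse of g is its adjoint for w, so acting on a tensor built from functionals w(a,.)
    amounts to moving the vectors a by g. *)
Lemma Sp_wV g X Y : Sp w g -> w X (g^-1%VF Y) = w (g X) Y.
Proof. by move=> [/eqP ker gw]; rewrite -gw lker0_lfunVK. Qed.
Lemma Sp_wVV g X Y : Sp w g -> w (g^-1%VF X) (g^-1%VF Y) = w X Y.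
Proof. by move=> [/eqP ker gw]; rewrite -gw !lker0_lfunVK. Qed.

Definition act g S : tensor V := tensor_act g S.
Lemma actE g S X Y Z : act g S X Y Z = S (g^-1%VF X) (g^-1%VF Y) (g^-1%VF Z) :> R.
Proof. exact: tensor_actE. Qed.

Definition Sp_invariant (W : {vspace tensor V}) := forall g S, Sp w g -> S \in W -> act g S \in W.

Definition irreducible (W : {vspace tensor V}) := [/\ Sp_invariant W, W <> 0%VS
  & forall U, Sp_invariant U -> (U <= W)%VS -> U = 0%VS \/ U = W].

Definition sym12 S := forall X Y Z, S X Y Z = S Y X Z :> R.
Definition cyclic_free S := forall X Y Z, S X Y Z + S Y Z X + S Z X Y = 0 :> R.
Definition sym_tensor S := sym12 S /\ forall X Y Z, S X Y Z = S X Z Y :> R.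

Lemma act_tens g a b c : Sp w g -> act g (tens a b c) = tens (g a) (g b) (g c).
Proof. by move=> Sg; apply/triP => X Y Z; rewrite actE !tensE !Sp_wV. Qed.

Lemma act_vec_tensor g U : Sp w g -> act g (vec_tensor U) = vec_tensor (g U).
Proof.
move=> Sg; apply/triP => X Y Z; rewrite actE !vec_tensorE !Sp_wVV //.
by rewrite !(skewC w _ U) !Sp_wV // !(skewC w (g U)) !opprK.
Qed.

Lemma act_hook g a b : Sp w g -> act g (hook a b) = hook (g a) (g b).
Proof. by move=> Sg; apply/triP => X Y Z; rewrite actE !hookE !Sp_wV. Qed.

End Tensors.

(** * Traces, pairings and transvections *)

Section DualPairs.
Variables (R : realType) (V : vectType R) (w : {skew_symmetric V}).
Implicit Types (S : tensor V) (X Y Z a b u v z : V) (g : 'End(V)).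

(** Two resolutions of the identity: traces and pairings use only these expansions, and Sp(V)
    preserves them. *)
Definition dual_pair (I : finType) (e d : I -> V) :=
  (forall X, \sum_i w X (d i) *: e i = X) /\ (forall Y, \sum_i w (e i) Y *: d i = Y).

Definition trace13 (I : finType) (e d : I -> V) S Z : R := \sum_i S (e i) Z (d i).

(** Expanding d in d' on one side and e' in e on the other leads to the same double sum. *)
Lemma trace13_indep (I J : finType) (e d : I -> V) (e' d' : J -> V) S Z :
  dual_pair e d -> dual_pair e' d' -> trace13 e d S Z = trace13 e' d' S Z.
Proof.
move=> [ed _] [_ de'].
transitivity (\sum_i \sum_k w (e' k) (d i) * S (e i) Z (d' k)).
  apply: eq_bigr => i _; rewrite -{1}[d i]de' tri_sum3.
  by apply: eq_bigr => k _; rewrite triZ3.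
rewrite exchange_big; apply: eq_bigr => k _; rewrite -[e' k in RHS]ed tri_sum1.
by apply: eq_bigr => i _; rewrite triZ1.
Qed.

(** The inverse of g maps dual pairs to dual pairs, and all of them give the same trace. *)
Lemma trace13_act (I : finType) (e d : I -> V) g S Z : Sp w g -> dual_pair e d ->
  trace13 e d (act g S) Z = trace13 e d S (g^-1%VF Z).
Proof.
move=> Sg ed; have [[/eqP ker _] [e1 d1]] := (Sg, ed).
rewrite (@trace13_indep _ _ e d (fun i => g^-1%VF (e i)) (fun i => g^-1%VF (d i)) S) //.
  by apply: eq_bigr => i _; rewrite actE.
split=> X.
  rewrite -[RHS](lker0_lfunK ker) -[g X]e1 linear_sum.
  by apply: eq_bigr => i _; rewrite linearZ Sp_wV.
rewrite -[RHS](lker0_lfunK ker) -[g X]d1 linear_sum.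
by apply: eq_bigr => i _; rewrite linearZ skewC Sp_wV // skewC opprK.
Qed.

Variables (I : finType) (e d : I -> V).
Hypothesis ed : dual_pair e d.

Definition S2_tensor S := [/\ sym12 S, cyclic_free S & forall Z, trace13 e d S Z = 0].

Lemma w_nondeg X : (forall Y, w X Y = 0) -> X = 0.
Proof. by move=> X0; rewrite -[X](ed.1) big1 // => i _; rewrite X0 scale0r. Qed.

Lemma w_nondegP X : X <> 0 -> exists Y, w X Y != 0.
Proof.
move=> X0; apply: contrapT => nY; apply: X0; apply: w_nondeg => Y.
by apply: contrapT => /eqP XY; apply: nY; exists Y.
Qed.

Lemma functional_repr (f : V -> R) : linear_for *%R f -> exists U, forall Z, f Z = w Z U.
Proof.
move=> f_lin; pose fM := GRing.isLinear.Build _ _ _ _ (f : V -> R^o) f_lin.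
pose fL : {linear V -> R^o} := HB.pack (f : V -> R^o) fM.
exists (\sum_i f (e i) *: d i) => Z.
rewrite -[f Z]/(fL Z) -{1}[Z](ed.1) linear_sum w_sum2.
by apply: eq_bigr => i _; rewrite linearZ wZ2 mulrC.
Qed.

(** A space, here the orthogonal of a, is not the union of two proper subspaces: one of z, z', z +
    z' works. For a = 0 the constraint on z is void. *)
Lemma common_nonzero a b u :
    (exists2 z, w a z = 0 & w b z != 0) -> (exists2 z, w a z = 0 & w u z != 0) ->
  exists z, [/\ w a z = 0, w b z != 0 & w u z != 0].
Proof.
move=> [z az bz] [z' az' uz'].
have [uz|uz] := eqVneq (w u z) 0; last by exists z.
have [bz'|bz'] := eqVneq (w b z') 0; last by exists z'.
by exists (z + z'); rewrite !wE az az' bz' uz !(addr0, add0r).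
Qed.

(** Transitivity on nonzero vectors, as a transfer principle for invariant predicates. Two
    transvections suffice, through some z orthogonal to neither a nor a'. *)
Lemma Sp_transitive (P : V -> Prop) a a' :
  (forall g x, Sp w g -> P x -> P (g x)) -> a <> 0 -> a' <> 0 -> P a -> P a'.
Proof.
move=> PSp a0 a'0.
(* The transvection along y - x that maps x to y. *)
have step x y : w y x != 0 -> P x -> P y.
  move=> yx Px; have -> : y = transvection w (y - x) (w y x)^-1 x.
    by rewrite transvectionE !wE skew_diag subr0 mulVf // scale1r addrC subrK.
  by apply: PSp => //; exact: Sp_transvection.
have nz x : x <> 0 -> exists2 z, w 0 z = 0 & w x z != 0.
  by move=> /w_nondegP[z xz]; exists z; rewrite ?w01.
have [z [_ az a'z]] := common_nonzero (nz _ a0) (nz _ a'0).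
by move=> /(step a z) Pz; apply: (step z) => //; apply: Pz; rewrite skewC oppr_eq0.
Qed.

(** The form on tensors induced by w, normalised so that pairing with [tens w a b c] evaluates at
    (a, b, c). *)
Definition pairing S S' : R :=
  \sum_i \sum_j \sum_k S (e i) (e j) (e k) * S' (d i) (d j) (d k).

Lemma pairing_linear1 S' : linear_for *%R (pairing^~ S').
Proof.
move=> a S1 S2; rewrite /pairing mulr_sumr -big_split; apply: eq_bigr => i _ /=.
rewrite mulr_sumr -big_split; apply: eq_bigr => j _ /=.
rewrite mulr_sumr -big_split; apply: eq_bigr => k _ /=.
by rewrite tri_add tri_scale; ring.
Qed.

Lemma pairing_linear2 S : linear_for *%R (pairing S).
Proof.
move=> a S1 S2; rewrite /pairing mulr_sumr -big_split; apply: eq_bigr => i _ /=.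
rewrite mulr_sumr -big_split; apply: eq_bigr => j _ /=.
rewrite mulr_sumr -big_split; apply: eq_bigr => k _ /=.
by rewrite tri_add tri_scale; ring.
Qed.

Lemma tri_expand S a b c :
  S a b c = \sum_i \sum_j \sum_k S (e i) (e j) (e k) * (w a (d i) * w b (d j) * w c (d k)) :> R.
Proof.
rewrite -[a in LHS](ed.1) tri_sum1; apply: eq_bigr => i _.
rewrite -[b in LHS](ed.1) tri_sum2; apply: eq_bigr => j _.
rewrite -[c in LHS](ed.1) tri_sum3; apply: eq_bigr => k _.
by rewrite triZ1 triZ2 triZ3; ring.
Qed.

Lemma pairing_tens S a b c : pairing S (tens w a b c) = S a b c.
Proof.
rewrite tri_expand; apply: eq_bigr => i _; apply: eq_bigr => j _; apply: eq_bigr => k _.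
by rewrite tensE.
Qed.

Lemma pairing_hook S a b : pairing S (hook w a b) = 2 * S a a b - S a b a - S b a a.
Proof.
rewrite !tri_expand mulr_sumr -!sumrB; apply: eq_bigr => i _.
rewrite mulr_sumr -!sumrB; apply: eq_bigr => j _.
rewrite mulr_sumr -!sumrB; apply: eq_bigr => k _.
by rewrite hookE; ring.
Qed.

Lemma sub_of_pairing (U W : {vspace tensor V}) : (U <= W)%VS ->
  (forall S, S \in W -> (forall S', S' \in U -> pairing S S' = 0) -> S = 0) -> U = W.
Proof.
move=> UW sep; apply/eqP; rewrite eqEdim UW.
exact: dimv_le_separated pairing_linear1 pairing_linear2 sep.
Qed.

(** Polarisation, twice: X + Y and X - Y separate S(X,X,Y) from S(X,Y,Y), then X + Y in the first
    two slots gives S(X,Y,Z). *)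
Lemma cubic_eq0 S : sym_tensor S -> (forall v, S v v v = 0 :> R) -> S = 0.
Proof.
move=> [s12 s23] S0.
have S1 X Y : S X X Y = 0 :> R.
  have := S0 (X + Y); have := S0 (X - Y); rewrite !triE !S0.
  by rewrite (s23 X Y X) (s12 Y X X) (s23 X Y X) (s12 Y X Y) (s23 Y Y X) (s12 Y X Y); lra.
apply/triP => X Y Z; rewrite tri_zero.
by have := S1 (X + Y) Z; rewrite !triE !S1 (s12 Y X); lra.
Qed.

Lemma tri_shift S X Y Z v (r s t : R) :
  S (X + r *: v) (Y + s *: v) (Z + t *: v) =
  S X Y Z + r * S v Y Z + s * S X v Z + t * S X Y v + r * s * S v v Z + r * t * S v Y v
  + s * t * S X v v + r * s * t * S v v v :> R.
Proof. by rewrite triD1 triZ1 !triD2 !triZ2 !triD3 !triZ3; ring. Qed.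

Lemma tri_lincomb (r : seq (R * tensor V)) X Y Z :
  (lincomb r : tensor V) X Y Z = \sum_(p <- r) p.1 * (p.2 : tensor V) X Y Z :> R.
Proof. by rewrite tri_sum; apply: eq_bigr => p _; rewrite tri_scale. Qed.

Lemma mem_comb (U : {vspace tensor V}) (r : seq (R * tensor V)) S :
  (forall p, p \in r -> p.2 \in U) ->
  (forall X Y Z, S X Y Z = \sum_(p <- r) p.1 * (p.2 : tensor V) X Y Z :> R) -> S \in U.
Proof.
move=> rU Sr; suff -> : S = lincomb r by exact: memv_lincomb.
by apply/triP => X Y Z; rewrite tri_lincomb Sr.
Qed.

(** The inverse transvection adds - t w(v,X) v to X, so the coefficient of t^3 is - S(v,v,v) times
    the cube. In A 2 - A (-2) - 2 (A 1 - A (-1)) the linear terms cancel and 12 times that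
    coefficient remains. *)
Lemma tens_cube_mem (U : {vspace tensor V}) S v : Sp_invariant w U ->
  S \in U -> sym_tensor S -> S v v v != 0 :> R -> tens w v v v \in U.
Proof.
move=> USp SU [s12 s23] Sv.
pose A t := act (transvection w v t) S.
have AU t : A t \in U by apply: USp => //; exact: Sp_transvection.
(* This combination of the A t isolates the coefficient of t^3. *)
pose k : R := (- 12 * (S v v v : R))^-1.
apply: (mem_comb (r := [:: (k, A 2); (- k, A (- 2)); (- 2 * k, A 1); (2 * k, A (- 1))]))
  => [p|X Y Z].
  by rewrite !inE => /or4P[]/eqP->; apply: AU.
rewrite !big_cons big_nil /= tensE /A !actE !transvectionV !transvectionE.
rewrite !tri_shift /k.
by field.
Qed.

(** The cyclic condition gives S(v,Y,v) = - S(v,v,Y) / 2, so the coefficient of t^2 is half of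
    [hook w v b]. *)
Lemma hook_mem (U : {vspace tensor V}) S v b : Sp_invariant w U ->
  S \in U -> sym12 S -> cyclic_free S ->
  (forall Z, S v v Z = w b Z :> R) -> hook w v b \in U.
Proof.
move=> USp SU s12 cyc Sb.
pose A t := act (transvection w v t) S.
have AU t : A t \in U by apply: USp => //; exact: Sp_transvection.
have svYv Y : S v Y v = - w b Y / 2 :> R.
  by have := cyc v v Y; rewrite -Sb (s12 Y v v); lra.
have wbv : w b v = 0 by have := svYv v; rewrite Sb; lra.
(* A 1 + A (- 1) - 2 S is twice the coefficient of t^2. *)
apply: (mem_comb (r := [:: (1, A 1); (1, A (- 1)); (- 2, S)])) => [p|X Y Z].
  by rewrite !inE => /or3P[]/eqP->; [exact: AU | exact: AU | exact: SU].
rewrite !big_cons big_nil /= hookE /A !actE !transvectionV !transvectionE.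
rewrite !tri_shift (s12 X v v) !svYv !Sb wbv.
by field.
Qed.

End DualPairs.

(** * Irreducibility *)

Section Irreducibility.
Variables (R : realType) (V : vectType R) (w : {skew_symmetric V}).
Variables (I : finType) (e d : I -> V).
Hypotheses (ed : dual_pair w e d) (w_ed : forall i j, w (e i) (d j) = (i == j)%:R).
Implicit Types (S : tensor V) (X Y Z a b u v z : V) (g : 'End(V)).

(** The first term of [vec_tensor] contracts to - w(Z,U), the second gives this |I| times. The
    factor is never zero, so the trace recovers U. *)
Lemma trace13_vec_tensor U Z :
  trace13 e d (vec_tensor w U) Z = - (#|I|.+1%:R * w Z U).
Proof.
transitivity (\sum_i (- (w Z (d i) * w (e i) U) - w Z U)).
  apply: eq_bigr => i _; rewrite vec_tensorE (skewC w (d i) Z) (skewC w (d i) (e i)).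
  by rewrite w_ed eqxx mulNr mulN1r.
have Zsum : \sum_i w Z (d i) * w (e i) U = w Z U.
  by rewrite -[in RHS](ed.1 Z) w_sum1; apply: eq_bigr => i _; rewrite wZ1.
by rewrite sumrB sumrN Zsum sumr_const -[X in _ - X]mulr_natl -natr1; ring.
Qed.

(** The last hypothesis makes S(v,v,.) a multiple of w(v,.). On the vectors e_i this leaves only the
    numbers c_i, through the formula [key], and the trace kills these. *)
Lemma trace_free_eq0 S : sym12 S -> (forall Z, trace13 e d S Z = 0) ->
  (forall v Z, w v Z = 0 -> S v v Z = 0 :> R) -> S = 0.
Proof.
move=> s12 tr S0; pose c i : R := S (e i) (e i) (d i).
have prop v v' Z : w v v' = 1 -> S v v Z = S v v v' * w v Z :> R.
  move=> vv'; have := S0 v (Z + (- w v Z) *: v').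
  by rewrite wD2 wZ2 vv' mulr1 subrr triD3 triZ3 => /(_ erefl); lra.
(* For i != j, compare the squares of e_i + e_j and e_i - e_j. *)
have key i j Z : 2 * S (e i) (e j) Z = c j * w (e i) Z + c i * w (e j) Z :> R.
  have [<-|ij] := eqVneq i j.
    by rewrite (prop (e i) (d i)) ?w_ed ?eqxx // /c; lra.
  have wij : w (e i) (d j) = 0 by rewrite w_ed (negbTE ij).
  have wji : w (e j) (d i) = 0 by rewrite w_ed eq_sym (negbTE ij).
  have wii k : w (e k) (d k) = 1 by rewrite w_ed eqxx.
  have wp : w (e i + e j) (d i) = 1 by rewrite wD1 wii wji addr0.
  have wm : w (e i + - e j) (d i) = 1 by rewrite wD1 wN1 wii wji subr0.
  have := prop _ _ (d j) wp; have := prop _ _ (d j) wm; have := prop _ _ Z wp.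
  rewrite !wD1 !wN1 wij wii !triD1 !triN1 !triD2 !triN2 !(s12 (e j) (e i)).
  have := prop _ _ Z (wii i); have := prop _ _ Z (wii j).
  rewrite (S0 _ _ wij) (S0 _ _ wji) /c => -> -> E1 E2 E3.
  have E4 : S (e i) (e j) (d i) = c j / 2 :> R by rewrite /c; lra.
  rewrite E4 /c in E1 *; lra.
(* In twice the trace at e_k, the first terms of [key] add up to |I| c_k and the second ones to
   c_k. *)
have c0 k : c k = 0.
  have /eqP : (#|I|.+1%:R * c k : R) = 0.
    rewrite -[RHS](mulr0 2) -[in RHS](tr (e k)) mulr_sumr.
    under eq_bigr => i _ do rewrite key w_ed eqxx mulr1 w_ed.
    rewrite big_split /= sumr_const -/(#|I|) (bigD1 k) //= eqxx mulr1 big1 ?addr0.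
      by rewrite -mulr_natl -natr1; ring.
    by move=> i /negbTE ik; rewrite eq_sym ik mulr0.
  by rewrite mulf_eq0 pnatr_eq0 => /eqP.
apply/triP => X Y Z; rewrite tri_zero (tri_expand ed).
rewrite big1 // => i _; rewrite big1 // => j _; rewrite big1 // => k _.
suff -> : S (e i) (e j) (e k) = 0 :> R by rewrite mul0r.
by have := key i j (e k); rewrite !c0; lra.
Qed.

(** The functional w(u,.) vanishes on the kernel of w(a,.), hence is c w(a,.), and the terms of the
    hook tensor cancel as 2c - c - c. *)
Lemma hook_proportional a u : a <> 0 -> (forall z, w a z = 0 -> w u z = 0) ->
  hook w a u = 0.
Proof.
move=> a0 au; have [y ay] := w_nondegP ed a0.
have [c uE] : exists c, forall Z, w u Z = c * w a Z.
  exists (w u y / w a y) => Z.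
  have := au (Z - (w a Z / w a y) *: y).
  by rewrite !wD2 !wN2 !wZ2 divfK // subrr => /(_ erefl)/subr0_eq ->; field.
by apply/triP => X Y Z; rewrite tri_zero hookE !uE; ring.
Qed.

Section HookOrbit.
Variable U : {vspace tensor V}.
Hypothesis USp : Sp_invariant w U.

(* The transvection along z fixes a and maps b to b + w(z,b) z, and hook is linear in its
   second argument. *)
Lemma hook_mem_shear a b z : hook w a b \in U -> w a z = 0 -> w b z != 0 -> hook w a z \in U.
Proof.
move=> Uab az bz; have zb : w z b != 0 by rewrite skewC oppr_eq0.
pose g := transvection w z 1.
have Ugab : act g (hook w a b) \in U by apply: USp => //; exact: Sp_transvection.
have za : w z a = 0 by rewrite skewC az oppr0.
rewrite act_hook in Ugab; last exact: Sp_transvection.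
apply: (mem_comb (r := [:: ((w z b)^-1, hook w (g a) (g b)); (- (w z b)^-1, hook w a b)])).
  by move=> p; rewrite !inE => /orP[]/eqP->.
move=> X Y Z; rewrite !big_cons big_nil /= !hookE /g !transvectionE za.
by rewrite mulr0 scale0r addr0 !wD1 !wZ1; field.
Qed.

(** The condition on z says that b is not a multiple of a. Having such a partner b is an
    Sp-invariant property of a, so every nonzero a' has a partner c. Two shears, from c to y and
    from y to b', reach each b' orthogonal to a' that is not a multiple of it; for multiples the
    hook tensor is 0. *)
Lemma hook_mem_all a b : a <> 0 -> w a b = 0 -> (exists2 z, w a z = 0 & w b z != 0) ->
  hook w a b \in U -> forall a' b', w a' b' = 0 -> hook w a' b' \in U.
Proof.
move=> a0 ab bz Uab a' b' a'b'.
have [->|/eqP a'0] := eqVneq a' 0.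
  have -> : hook w 0 b' = 0 by apply/triP => X Y Z; rewrite tri_zero hookE !w01; ring.
  exact: mem0v.
have [c [a'c c_a' Uac]] : exists c,
    [/\ w a' c = 0, exists2 z, w a' z = 0 & w c z != 0 & hook w a' c \in U].
  pose P x := exists c, [/\ w x c = 0, exists2 z, w x z = 0 & w c z != 0 & hook w x c \in U].
  apply: (@Sp_transitive _ _ w _ e d ed P a a') => // [g x Sg|]; last by exists b.
  case=> c [xc [z xz cz] Uxc]; exists (g c); have gw := Sg.2; split.
  - by rewrite gw.
  - by exists (g z); rewrite gw.
  - by rewrite -act_hook //; exact: USp.
have [[z a'z b'z]|nz] := pselect (exists2 z, w a' z = 0 & w b' z != 0).
  have [y [a'y cy b'y]] := common_nonzero c_a' (ex_intro2 _ _ z a'z b'z).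
  apply: (@hook_mem_shear _ y) => //; first exact: (@hook_mem_shear _ c).
  by rewrite skewC oppr_eq0.
rewrite hook_proportional //; first exact: mem0v.
by move=> z a'z; apply: contrapT => /eqP b'z; apply: nz; exists z.
Qed.
End HookOrbit.

(** S_1 is an equivariant image of V, and Sp(V) is transitive on nonzero vectors. *)
Lemma irreducible_S1 (W : {vspace tensor V}) :
  (forall S, S \in W <-> exists U, S = vec_tensor w U) -> W <> 0%VS -> irreducible w W.
Proof.
move=> WP W0.
have vecP S : S \in W -> exists U, S = vec_tensor w U by move/WP.
have vecW U : vec_tensor w U \in W by apply/WP; exists U.
split=> // [g S Sg /vecP[U ->]|U USp UW]; first by rewrite act_vec_tensor.
have vec0 : vec_tensor w 0 = 0 by apply/triP => X Y Z; rewrite tri_zero vec_tensorE !w02; ring.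
have [->|[S SU S0]] := subv_eq0_or_nonzero U; [by left | right].
have [u Su] := vecP S (subvP UW _ SU); rewrite {}Su in SU S0.
apply: vspace_anti UW _ => _ /vecP[x ->].
have [->|/eqP x0] := eqVneq x 0; first by rewrite vec0 mem0v.
apply: (@Sp_transitive _ _ w _ e d ed (fun x => vec_tensor w x \in U) u x) => //.
  by move=> g y Sg Uy; rewrite -act_vec_tensor //; exact: USp.
by move=> u0; apply: S0; rewrite u0 vec0.
Qed.

Lemma irreducible_S2 (W : {vspace tensor V}) :
  (forall S, S \in W <-> S2_tensor e d S) -> W <> 0%VS -> irreducible w W.
Proof.
move=> WP W0; split=> // [g S Sg /WP[s12 cyc tr]|U USp UW].
  apply/WP; split=> [X Y Z|X Y Z|Z]; rewrite ?actE //.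
  by rewrite (trace13_act S Z Sg ed).
have [->|[S SU S0]] := subv_eq0_or_nonzero U; [by left | right].
have SW : S \in W by exact: subvP UW _ SU.
have [s12 cyc tr] := (WP S).1 SW.
(* Such v and Z exist since otherwise the trace-free S would vanish. *)
have [v [Z vZ SvZ]] : exists v, exists2 Z, w v Z = 0 & (S v v Z : R) != 0.
  apply: contrapT => nS; apply: S0; apply: trace_free_eq0 => // v Z vZ.
  by apply: contrapT => /eqP SvZ; apply: nS; exists v, Z.
have [b0 Sb0] : exists b, forall Z, S v v Z = w Z b :> R.
  by apply: (functional_repr ed) => c x y; rewrite triD3 triZ3.
have Sb z : S v v z = w (- b0) z :> R by rewrite wN1 -skewC.
have Uvb : hook w v (- b0) \in U by exact: hook_mem Sb.
have v0 : v <> 0 by move=> v0; move: SvZ; rewrite v0 tri01 eqxx.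
have wvb : w v (- b0) = 0.
  by rewrite skewC -Sb; have := cyc v v v; lra.
have nvb : exists2 z, w v z = 0 & w (- b0) z != 0 by exists Z; rewrite -?Sb.
apply: (@sub_of_pairing _ _ _ e d _ _ UW) => S' /WP[s12' cyc' tr'] pS'.
apply: trace_free_eq0 => // x y xy.
(* On S_2 the pairing with the hook tensor of (x, y) is 3 S'(x,x,y). *)
have := pS' _ (hook_mem_all USp v0 wvb nvb Uvb xy).
by rewrite (pairing_hook ed); have := cyc' x x y; rewrite (s12' y x x); lra.
Qed.

Lemma irreducible_S3 (W : {vspace tensor V}) : (forall S, S \in W <-> sym_tensor S) ->
  W <> 0%VS -> irreducible w W.
Proof.
move=> WP W0; split=> // [g S Sg /WP[s12 s23]|U USp UW].
  by apply/WP; split=> X Y Z; rewrite !actE.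
have [->|[S SU S0]] := subv_eq0_or_nonzero U; [by left | right].
have S3 : sym_tensor S by apply/WP; exact: subvP UW _ SU.
have [v Sv] : exists v, (S v v v : R) != 0.
  apply: contrapT => nS; apply: S0; apply: cubic_eq0 => // v.
  by apply: contrapT => /eqP Sv; apply: nS; exists v.
have Uv : tens w v v v \in U by exact: tens_cube_mem Sv.
apply: (@sub_of_pairing _ _ _ e d _ _ UW) => S' /WP S'3 pS'.
apply: cubic_eq0 => // x; have [->|/eqP x0] := eqVneq x 0; first exact: tri01.
rewrite -(pairing_tens ed); apply: pS'.
apply: (@Sp_transitive _ _ w _ e d ed (fun x => tens w x x x \in U) v x) => //.
  by move=> g y Sg Uy; rewrite -act_tens //; exact: USp.
by move=> v0; move: Sv; rewrite v0 tri01 eqxx.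
Qed.

End Irreducibility.

(** * Decomposition *)

Section Decomposition.
Variables (R : realType) (V : vectType R) (w : {skew_symmetric V}).
Variables (I : finType) (e d : I -> V).
Hypotheses (ed : dual_pair w e d) (w_ed : forall i j, w (e i) (d j) = (i == j)%:R).
Implicit Types (S : tensor V) (X Y Z : V).

Lemma vspace_of_tensors (P : tensor V -> Prop) :
  (forall S, (forall X Y Z, S X Y Z = 0 :> R) -> P S) ->
  (forall (a : R) S1 S2 S, P S1 -> P S2 ->
     (forall X Y Z, S X Y Z = a * S1 X Y Z + S2 X Y Z :> R) -> P S) ->
  exists W : {vspace tensor V}, forall S, S \in W <-> P S.
Proof.
move=> P0 Plin; apply: vspace_of_closed.
  by apply: P0 => X Y Z; exact: tri_zero.
have lin2 (T : vectType R) (a : R) (x y : T) : a *: x + y = lincomb [:: (a, x); (1, y)].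
  by rewrite /lincomb !big_cons big_nil addr0 scale1r.
move=> a S1 S2 PS1 PS2; rewrite lin2; apply: (Plin a S1 S2) => // X Y Z.
apply: etrans (tri_lincomb _ X Y Z) _.
by rewrite big_cons big_seq1 mul1r.
Qed.

Lemma sym12_vspace : exists W : {vspace tensor V}, forall S, S \in W <-> sym12 S.
Proof.
apply: vspace_of_tensors => [S S0 X Y Z|a S1 S2 S s1 s2 SE X Y Z].
  by apply: etrans (S0 X Y Z) (esym (S0 Y X Z)).
by apply: etrans (SE X Y Z) _; rewrite s1 s2; exact: esym (SE Y X Z).
Qed.

Lemma vec_tensor_vspace :
  exists W : {vspace tensor V}, forall S, S \in W <-> exists U, S = vec_tensor w U.
Proof.
apply: vspace_of_tensors => [S S0|a S1 S2 S [U1 ->] [U2 ->] SE].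
  by exists 0; apply/triP => X Y Z; rewrite S0 vec_tensorE !w02; ring.
by exists (a *: U1 + U2); apply/triP => X Y Z; rewrite SE !vec_tensorE !wD2 !wZ2; ring.
Qed.

Lemma sym_tensor_vspace : exists W : {vspace tensor V}, forall S, S \in W <-> sym_tensor S.
Proof.
apply: vspace_of_tensors => [S S0|a S1 S2 S [s1 t1] [s2 t2] SE]; split=> X Y Z.
- exact: etrans (S0 X Y Z) (esym (S0 Y X Z)).
- exact: etrans (S0 X Y Z) (esym (S0 X Z Y)).
- by apply: etrans (SE X Y Z) _; rewrite s1 s2; exact: esym (SE Y X Z).
- by apply: etrans (SE X Y Z) _; rewrite t1 t2; exact: esym (SE X Z Y).
Qed.

Lemma S2_tensor_vspace : exists W : {vspace tensor V}, forall S, S \in W <-> S2_tensor e d S.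
Proof.
apply: vspace_of_tensors => [S S0|a S1 S2 S [s1 c1 t1] [s2 c2 t2] SE]; split=> [X Y Z|X Y Z|Z].
- exact: etrans (S0 X Y Z) (esym (S0 Y X Z)).
- by rewrite !S0 !addr0.
- by rewrite /trace13 big1 // => i _; exact: S0.
- by apply: etrans (SE X Y Z) _; rewrite s1 s2; exact: esym (SE Y X Z).
- by rewrite !SE; have := c1 X Y Z; have := c2 X Y Z; nra.
- transitivity (a * trace13 e d S1 Z + trace13 e d S2 Z); last by rewrite t1 t2 mulr0 addr0.
  by rewrite /trace13 mulr_sumr -big_split; apply: eq_bigr => i _; exact: SE.
Qed.

Lemma tensor_independent S1 S2 S3 :
  (exists U, S1 = vec_tensor w U) -> S2_tensor e d S2 -> sym_tensor S3 ->
  (forall X Y Z, S1 X Y Z + S2 X Y Z + S3 X Y Z = 0 :> R) -> [/\ S1 = 0, S2 = 0 & S3 = 0].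
Proof.
move=> [U ->] [s2 c2 t2] [s3 s3'] S0.
(* The cyclic sum of the relation leaves 3 S3, as it kills S1 and S2. *)
have S30 X Y Z : S3 X Y Z = 0 :> R.
  have := S0 X Y Z; have := S0 Y Z X; have := S0 Z X Y; have := c2 X Y Z.
  rewrite !vec_tensorE (s3' Y Z X) (s3 Y X Z) (s3 Z X Y) (s3' X Z Y).
  by rewrite (skewC w Y Z) (skewC w X Y) (skewC w X Z); nra.
have S12 X Y Z : S2 X Y Z = - vec_tensor w U X Y Z :> R.
  by have := S0 X Y Z; rewrite S30; lra.
(* Since S2 is trace-free, S1 = - S2 has trace 0, which determines U. *)
have U0 : U = 0.
  apply: (w_nondeg ed) => Z; rewrite skewC.
  suff /eqP : (#|I|.+1%:R * w Z U : R) = 0.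
    by rewrite mulf_eq0 pnatr_eq0 => /eqP->; rewrite oppr0.
  rewrite -[LHS]opprK -(trace13_vec_tensor ed w_ed) -[RHS](t2 Z) /trace13 -sumrN.
  by apply: eq_bigr => i _; rewrite S12.
have vec0 X Y Z : vec_tensor w U X Y Z = 0 :> R by rewrite vec_tensorE U0 !w02; ring.
by split; apply/triP => X Y Z; rewrite tri_zero ?vec0 ?S30 // S12 vec0 oppr0.
Qed.

(** S3 is the cyclic mean of S, S1 accounts for the trace of S - S3, and S2 is the remainder. *)
Lemma tensor_decomposition S : sym12 S -> exists S1 S2 S3,
  [/\ exists U, S1 = vec_tensor w U, S2_tensor e d S2, sym_tensor S3
    & forall X Y Z, S X Y Z = S1 X Y Z + S2 X Y Z + S3 X Y Z :> R].
Proof.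
move=> s12; pose S3 := tri_of (fun X Y Z => (S X Y Z + S Y Z X + S Z X Y : R) / 3).
have S3E X Y Z : S3 X Y Z = (S X Y Z + S Y Z X + S Z X Y : R) / 3 :> R.
  rewrite tri_ofE //; split=> A B a C D /=; rewrite !triD1 !triD2 !triD3 !triZ1 !triZ2 !triZ3;
  by field.
have [U0 U0E] : exists U, forall Z, trace13 e d S Z - trace13 e d S3 Z = w Z U.
  apply: (functional_repr ed) => a X Y; rewrite /trace13 -!sumrB mulr_sumr -big_split.
  by apply: eq_bigr => i _ /=; rewrite !triD2 !triZ2; ring.
(* This factor inverts the one in [trace13_vec_tensor], so S1 has trace w(Z,U0). *)
pose U := (- (#|I|.+1%:R)^-1) *: U0; pose S1 := vec_tensor w U.
pose S2 := tri_of (fun X Y Z => S X Y Z - S1 X Y Z - S3 X Y Z : R).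
have S2E X Y Z : S2 X Y Z = S X Y Z - S1 X Y Z - S3 X Y Z :> R.
  rewrite tri_ofE //; split=> A B a C D /=; rewrite ?triD1 ?triZ1 ?triD2 ?triZ2 ?triD3 ?triZ3;
  by ring.
exists S1, S2, S3; split; last by move=> X Y Z; rewrite S2E; ring.
- by exists U.
- split=> [X Y Z|X Y Z|Z].
  + by rewrite !S2E !S3E /S1 !vec_tensorE (s12 Y X Z) (s12 Y Z X) (s12 X Z Y); ring.
  + rewrite !S2E !S3E /S1 !vec_tensorE (skewC w Y Z) (skewC w X Y) (skewC w X Z).
    by field.
  + transitivity (trace13 e d S Z - trace13 e d S3 Z - trace13 e d S1 Z).
      by rewrite /trace13 -!sumrB; apply: eq_bigr => i _; rewrite S2E; ring.
    rewrite U0E (trace13_vec_tensor ed w_ed) /U wZ2.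
    by rewrite mulNr mulrN mulrA mulfV ?pnatr_eq0 // mul1r opprK subrr.
- split=> X Y Z; rewrite !S3E; first by rewrite (s12 Y X Z) (s12 X Z Y) (s12 Z Y X); ring.
  by rewrite (s12 X Z Y) (s12 Z Y X) (s12 Y X Z); ring.
Qed.

End Decomposition.

(** * Symplectic bases as dual pairs *)

Section SymplecticBasis.
Variables (R : realType) (V : vectType R) (w : {skew_symmetric V}) (n : nat).
Variable e : (n + n).-tuple V.
Hypothesis we : symplectic_basis w e.

(** The sign in the second half makes this dual to e under w, and turns the differences in [s13]
    into one sum over all 2n indices. *)
Definition dual_basis (i : 'I_(n + n)) : V :=
  match split i with inl j => tnth e (rshift n j) | inr j => - tnth e (lshift n j) end.

Lemma dual_basis_lshift j : dual_basis (lshift n j) = tnth e (rshift n j).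
Proof. by rewrite /dual_basis (unsplitK (inl j)). Qed.

Lemma dual_basis_rshift j : dual_basis (rshift n j) = - tnth e (lshift n j).
Proof. by rewrite /dual_basis (unsplitK (inr j)). Qed.

Lemma w_dual_basis i j : w (tnth e i) (dual_basis j) = (i == j)%:R.
Proof.
case: (split_ordP i) => i' ->; case: (split_ordP j) => j' ->;
  rewrite ?dual_basis_lshift ?dual_basis_rshift ?wN2 eq_shift.
- by have [-> _ _] := we.2 i' j'.
- by have [_ -> _] := we.2 i' j'; rewrite oppr0.
- by have [_ _ ->] := we.2 i' j'.
- by rewrite -skewC; have [-> _ _] := we.2 j' i'; rewrite eq_sym.
Qed.

Lemma dual_pair_dual_basis : dual_pair w (tnth e) dual_basis.
Proof.
have expand X : \sum_i w X (dual_basis i) *: tnth e i = X.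
  rewrite [RHS](coord_basis we.1 (memvf X)); apply: eq_bigr => i _.
  rewrite (tnth_nth 0); congr (_ *: _).
  rewrite {1}(coord_basis we.1 (memvf X)) w_sum1 (bigD1 i) //= big1 ?addr0 => [|j ji].
    by rewrite wZ1 -tnth_nth w_dual_basis eqxx mulr1.
  by rewrite wZ1 -tnth_nth w_dual_basis (negbTE ji) mulr0.
(* The error Z in the second expansion is orthogonal to every e_k, hence to all vectors by the first
   expansion, which then gives Z = 0. *)
split=> // Y; apply/eqP; rewrite -subr_eq0; apply/eqP; set Z := (X in X = 0).
have eZ k : w (tnth e k) Z = 0.
  rewrite wD2 wN2 w_sum2 (bigD1 k) //= big1 ?addr0 => [|j jk].
    by rewrite wZ2 w_dual_basis eqxx mulr1 subrr.
  by rewrite wZ2 w_dual_basis eq_sym (negbTE jk) mulr0.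
rewrite -[LHS]expand big1 // => i _.
rewrite skewC -(expand (dual_basis i)) w_sum1 big1 ?oppr0 ?scale0r // => k _.
by rewrite wZ1 eZ mulr0.
Qed.

Lemma s13_trace S Z : s13 e S Z = trace13 (tnth e) dual_basis S Z.
Proof.
rewrite /trace13 big_split_ord /= /s13 big_split; congr (_ + _); apply: eq_bigr => i _.
  by rewrite dual_basis_lshift.
by rewrite dual_basis_rshift triN3.
Qed.

End SymplecticBasis.

(** * Dimensions *)

(** The two symmetries are the adjacent transpositions, which generate the symmetric group; its six
    elements are treated case by case. *)
Lemma in_S3_totally_symmetric (R : realType) (V : vectType R) (S : trilinear R V) :
  in_S3 S <-> totally_symmetric S.
Proof.
split=> [[s12 s23] s x|sym].
  have ord3 (i : 'I_3) : [\/ i = 0, i = 1 | i = 2].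
    by case: i => [[|[|[|//]]] lt]; [apply: Or31 | apply: Or32 | apply: Or33]; exact: val_inj.
  have s01 : s 0 != s 1 by rewrite (inj_eq perm_inj).
  have s02 : s 0 != s 2 by rewrite (inj_eq perm_inj).
  have s12' : s 1 != s 2 by rewrite (inj_eq perm_inj).
  move: s01 s02 s12'; case: (ord3 (s 0)) => ->; case: (ord3 (s 1)) => ->;
    case: (ord3 (s 2)) => ->; rewrite ?eqxx // => _ _ _.
  - by rewrite s23 s12.
  - by rewrite s12 s23.
  - by rewrite s12 s23 s12.
pose x3 X Y Z (i : 'I_3) : V := [:: X; Y; Z]`_i.
split=> X Y Z.
  by have := sym (tperm 0 1) (x3 Y X Z); rewrite tpermL tpermR tpermD.
by have := sym (tperm 1 2) (x3 X Z Y); rewrite tpermL tpermR tpermD.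
Qed.

Section Dimensions.
Variables (R : realType) (V : vectType R) (w : {skew_symmetric V}) (m : nat).
Variables (e d : 'I_m -> V).
Hypotheses (ed : dual_pair w e d) (w_ed : forall i j, w (e i) (d j) = (i == j)%:R).
Implicit Types (S : tensor V) (X Y Z : V).

Lemma tensor_of_coords (f : 'I_m -> 'I_m -> 'I_m -> R) :
  exists S, forall i j k, S (e i) (e j) (e k) = f i j k :> R.
Proof.
(* The functionals w(- d_i, .) are dual to the vectors e_j. *)
pose T (p : 'I_m * 'I_m * 'I_m) := tens w (- d p.1.1) (- d p.1.2) (- d p.2).
exists (lincomb [seq (f p.1.1 p.1.2 p.2, T p) | p <- index_enum _]) => i j k.
have dual a b : w (- d a) (e b) = (a == b)%:R by rewrite wN1 -skewC w_ed eq_sym.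
apply: etrans (tri_lincomb _ _ _ _) _.
rewrite big_map (bigD1 (i, j, k)) //= big1 ?addr0 => [|[[a b] c] /= abc].
  by rewrite tensE !dual !eqxx !mulr1.
rewrite tensE !dual -!natrM !mulnb.
have -> : (a == i) && (b == j) && (c == k) = false; last by rewrite mulr0.
by apply: contraNF abc => /andP[/andP[/eqP-> /eqP->] /eqP->].
Qed.

Lemma tensor_coords_inj S : (forall i j k, S (e i) (e j) (e k) = 0 :> R) -> S = 0.
Proof.
move=> S0; apply/triP => X Y Z; rewrite tri_zero (tri_expand ed).
rewrite big1 // => i _; rewrite big1 // => j _; rewrite big1 // => k _.
by rewrite S0 mul0r.
Qed.

Lemma sym12_coords S :
  (forall i j k, S (e i) (e j) (e k) = S (e j) (e i) (e k) :> R) -> sym12 S.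
Proof.
move=> Sb X Y Z; rewrite !(tri_expand ed) exchange_big.
apply: eq_bigr => j _; apply: eq_bigr => i _; apply: eq_bigr => k _.
by rewrite Sb; ring.
Qed.

Lemma sym_tensor_coords S :
  (forall i j k, S (e i) (e j) (e k) = S (e j) (e i) (e k) :> R) ->
  (forall i j k, S (e i) (e j) (e k) = S (e i) (e k) (e j) :> R) -> sym_tensor S.
Proof.
move=> Sb Sb'; split; first exact: sym12_coords.
move=> X Y Z; rewrite !(tri_expand ed); apply: eq_bigr => i _; rewrite exchange_big.
by apply: eq_bigr => j _; apply: eq_bigr => k _; rewrite Sb'; ring.
Qed.

(** The traces at the e_i serve as coordinates, being - (m+1) w(e_i, U). *)
Lemma dim_S1 (W : {vspace tensor V}) :
  (forall S, S \in W <-> exists U, S = vec_tensor w U) -> \dim W = m.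
Proof.
move=> WP; have m0 : (m.+1%:R : R) != 0 by rewrite pnatr_eq0.
have trE U i : trace13 e d (vec_tensor w U) (e i) = - (m.+1%:R * w (e i) U).
  by rewrite (trace13_vec_tensor ed w_ed) card_ord.
rewrite (@dimv_of_coords _ _ W _ setT (fun S i => trace13 e d S (e i))).
- by rewrite cardsT card_ord.
- move=> i a S S'; rewrite /trace13 mulr_sumr -big_split; apply: eq_bigr => j _ /=.
  by rewrite tri_add tri_scale.
- move=> S /WP[U ->] tr0.
  have U0 : U = 0.
    rewrite -(ed.2 U) big1 // => i _; have /eqP := tr0 i (in_setT i).
    by rewrite trE oppr_eq0 mulf_eq0 (negbTE m0) => /eqP->; rewrite scale0r.
  by apply/triP => X Y Z; rewrite tri_zero vec_tensorE U0 !w02; ring.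
move=> i _; exists (vec_tensor w (- (m.+1%:R^-1) *: d i)).
  by apply/WP; exists (- (m.+1%:R^-1) *: d i).
by move=> j _; rewrite trE wZ2 w_ed eq_sym mulNr mulrN opprK mulrA mulfV // mul1r.
Qed.

(** Coordinates are indexed by a multiset of two indices for the symmetric slots and a free third
    index. *)
Lemma dim_sym12 (W : {vspace tensor V}) :
  (forall S, S \in W <-> sym12 S) -> \dim W = ('C(m.+1, 2) * m)%N.
Proof.
move=> WP.
pose r (x : 2.-tuple 'I_m * 'I_m) := (sort_ord x.1, x.2).
pose ev S (x : 2.-tuple 'I_m * 'I_m) : R :=
  S (e (tnth x.1 0)) (e (tnth x.1 1)) (e x.2).
rewrite (@dimv_of_orbits _ _ W _ r ev).
- have -> : [set x | r x == x] = setX [set t | sort_ord t == t] setT.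
    by apply/setP => -[t k]; rewrite !inE xpair_eqE eqxx !andbT.
  by rewrite cardsX card_sort_ord // cardsT card_ord.
- by move=> x a S S'; rewrite /ev tri_add tri_scale.
- by move=> x; rewrite /r sort_ord_idem.
- move=> S S0; apply: tensor_coords_inj => i j k.
  by have := S0 ([tuple i; j], k); rewrite /ev !(tnth_nth i).
- move=> f; have [S SE] := tensor_of_coords (fun i j k => f ([tuple i; j], k)).
  exists S => -[t k]; rewrite /ev SE /=; congr (f (_, k)).
  apply: eq_from_tnth => -[[|[|//]] lt]; rewrite (tnth_nth (tnth t 0)) /=; congr tnth;
  exact: val_inj.
move=> S; split=> [/WP sym [t k]|Sr].
  have ord2 (i : 'I_2) : i = 0 \/ i = 1.
    by case: i => [[|[|//]] lt]; [left | right]; exact: val_inj.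
  have /tuple_permP[s sE] := perm_sort_ord t.
  have tE i : tnth (sort_ord t) i = tnth t (s i).
    by rewrite -[RHS](tnth_mktuple (fun i => tnth t (s i))); congr tnth; exact: val_inj.
  rewrite /ev /= !tE; have : s 0 != s 1 by rewrite (inj_eq perm_inj).
  by case: (ord2 (s 0)) => ->; case: (ord2 (s 1)) => -> // _; exact: sym.
apply/WP; apply: sym12_coords => i j k.
have pij : perm_eq [tuple i; j] [tuple j; i] by apply/seq.permP => P /=; rewrite !addn0 addnC.
have := Sr ([tuple i; j], k); rewrite {1}/ev /= (sort_ord_perm pij).
have := Sr ([tuple j; i], k); rewrite {1}/ev /= => ->.
by rewrite /ev !(tnth_nth i) /=.
Qed.

Lemma dim_S3 (W : {vspace tensor V}) :
  (forall S, S \in W <-> sym_tensor S) -> \dim W = 'C(m.+2, 3).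
Proof.
move=> WP.
pose ev S (x : 3.-tuple 'I_m) : R := S (e (tnth x 0)) (e (tnth x 1)) (e (tnth x 2)).
rewrite (@dimv_of_orbits _ _ W _ (@sort_ord m 3) ev).
- by rewrite card_sort_ord.
- by move=> x a S S'; rewrite /ev tri_add tri_scale.
- exact: sort_ord_idem.
- move=> S S0; apply: tensor_coords_inj => i j k.
  by have := S0 [tuple i; j; k]; rewrite /ev !(tnth_nth i).
- move=> f; have [S SE] := tensor_of_coords (fun i j k => f [tuple i; j; k]).
  exists S => t; rewrite /ev SE; congr f; apply: eq_from_tnth.
  by move=> -[[|[|[|//]]] lt]; rewrite (tnth_nth (tnth t 0)) /=; congr tnth; exact: val_inj.
move=> S; split=> [/WP/in_S3_totally_symmetric sym t|Sr].
  have /tuple_permP[s sE] := perm_sort_ord t.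
  have tE i : tnth (sort_ord t) i = tnth t (s i).
    by rewrite -[RHS](tnth_mktuple (fun i => tnth t (s i))); congr tnth; exact: val_inj.
  by rewrite /ev !tE; exact: (sym s (fun i => e (tnth t i))).
have Sperm (t t' : 3.-tuple 'I_m) : perm_eq t t' -> ev S t = ev S t'.
  by move=> tt'; rewrite -(Sr t) -(Sr t') (sort_ord_perm tt').
apply/WP; apply: sym_tensor_coords => i j k.
  have : perm_eq [tuple i; j; k] [tuple j; i; k].
    by apply/seq.permP => P /=; rewrite !addn0 addnCA.
  by move/Sperm; rewrite /ev !(tnth_nth i).
have : perm_eq [tuple i; j; k] [tuple i; k; j].
  by apply/seq.permP => P /=; rewrite !addn0 [(P k + P j)%N]addnC.
by move/Sperm; rewrite /ev !(tnth_nth i).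
Qed.

End Dimensions.

(** * Assembly *)

Lemma directv3 (F : fieldType) (T : vectType F) (W W1 W2 W3 : {vspace T}) :
  (W1 <= W)%VS -> (W2 <= W)%VS -> (W3 <= W)%VS ->
  (forall x, x \in W ->
     exists x1 x2 x3, [/\ x1 \in W1, x2 \in W2, x3 \in W3 & x = x1 + x2 + x3]) ->
  (forall x1 x2 x3, x1 \in W1 -> x2 \in W2 -> x3 \in W3 -> x1 + x2 + x3 = 0 ->
     [/\ x1 = 0, x2 = 0 & x3 = 0]) ->
  W = (W1 + W2 + W3)%VS /\ directv (W1 + W2 + W3).
Proof.
move=> W1W W2W W3W dec ind; split.
  apply/eqP; rewrite eqEsubv !subv_add W1W W2W W3W !andbT.
  by apply/subvP => x /dec[x1 [x2 [x3 [m1 m2 m3 ->]]]]; rewrite !memv_add.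
have cap12 : (W1 :&: W2 = 0)%VS.
  apply/eqP; rewrite -subv0; apply/subvP => x /memv_capP[x1 x2].
  rewrite -memvN in x2; have x0 : x - x + 0 = 0 by rewrite subrr addr0.
  by have [-> _ _] := ind _ _ _ x1 x2 (mem0v _) x0; exact: mem0v.
have cap3 : ((W1 + W2) :&: W3 = 0)%VS.
  apply/eqP; rewrite -subv0; apply/subvP => x /memv_capP[/memv_addP[x1 m1 [x2 m2 xE]] m3].
  rewrite -memvN in m3; have x0 : x1 + x2 - x = 0 by rewrite -xE subrr.
  by have [_ _ /eqP] := ind _ _ _ m1 m2 m3 x0; rewrite oppr_eq0 => /eqP->; exact: mem0v.
by apply/directvP; rewrite /= !dimv_disjoint_sum.
Qed.

(** The hypothesis is the dimension count of the direct sum, with n + n the dimension of V and k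
    that of S_2. *)
Lemma dim_S2_arith (R : realFieldType) (n k : nat) :
  ('C((n + n).+1, 2) * (n + n) = n + n + k + 'C((n + n).+2, 3))%N ->
  k%:R = 8 / 3 * (n%:R ^+ 3 - n%:R) :> R.
Proof.
have c2 : ('C((n + n).+1, 2) * 2 = (n + n + 1) * (n + n))%N.
  by rewrite -[2%N in LHS]/(2`!) bin_ffact ffactSS ffactn1 addn1.
have c3 : ('C((n + n).+2, 3) * 6 = (n + n + 2) * ((n + n + 1) * (n + n)))%N.
  by rewrite -[6%N in LHS]/(3`!) bin_ffact !ffactSS ffactn1 addn1 addn2.
have natR (a b : nat) : a = b -> a%:R = b%:R :> R by move->.
move: c2 c3; move: 'C(_, 2) 'C(_, 3) => b2 b3 /natR + /natR + /natR.
rewrite !natrM !natrD => E2 E3 Ek.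
have b2E : b2%:R = (2 * n%:R + 1) * n%:R :> R by lra.
by rewrite b2E in Ek; lra.
Qed.

(** Lets a single subspace serve as S_2 for every symplectic basis. *)
Lemma S2_tensor_basis (R : realType) (V : vectType R) (w : {skew_symmetric V})
    (I J : finType) (e d : I -> V) (e' d' : J -> V) :
  dual_pair w e d -> dual_pair w e' d' ->
  forall S, S2_tensor e d S <-> S2_tensor e' d' S.
Proof.
move=> ed ed' S; have trE Z := trace13_indep S Z ed ed'.
by split=> -[s12 cyc tr]; split=> // Z; [rewrite -trE | rewrite trE].
Qed.

(* The conclusion over an arbitrary carrier T: passing from [tensor V] to the convertible iterated
   ['Hom] then only compares the arguments of this constant. *)
Definition decomposition (R : realType) (V : vectType R) (n : nat) (w : {skew_symmetric V})
    (F : fieldType) (T : vectType F) (P P1 : T -> Prop) (P2 : (n + n).-tuple V -> T -> Prop)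
    (P3 P3' : T -> Prop) (irr : {vspace T} -> Prop) : Prop :=
  exists W W1 W2 W3 : {vspace T},
  [/\ forall S, S \in W <-> P S, forall S, S \in W1 <-> P1 S,
      forall e : (n + n).-tuple V, symplectic_basis w e -> forall S, S \in W2 <-> P2 e S,
      forall S, S \in W3 <-> P3 S & forall S, S \in W3 <-> P3' S] /\
  [/\ (2 <= n)%N ->
        [/\ W = (W1 + W2 + W3)%VS, directv (W1 + W2 + W3), irr W1, irr W2 & irr W3],
      n = 1%N -> [/\ W = (W1 + W3)%VS, directv (W1 + W3), irr W1 & irr W3],
      \dim W1 = (2 * n)%N, (\dim W2)%:R = 8 / 3 * (n%:R ^+ 3 - n%:R) :> R
    & \dim W3 = 'C(2 * n + 2, 3)].

Lemma decomposition_mono (R : realType) (V : vectType R) (n : nat) (w : {skew_symmetric V})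
    (F : fieldType) (T : vectType F) (P P1 Q Q1 : T -> Prop)
    (P2 Q2 : (n + n).-tuple V -> T -> Prop) (P3 P3' Q3 Q3' : T -> Prop)
    (irr irr' : {vspace T} -> Prop) :
  (forall S, P S <-> Q S) -> (forall S, P1 S <-> Q1 S) -> (forall e S, P2 e S <-> Q2 e S) ->
  (forall S, P3 S <-> Q3 S) -> (forall S, P3' S <-> Q3' S) -> (forall W, irr W -> irr' W) ->
  decomposition w P P1 P2 P3 P3' irr -> decomposition w Q Q1 Q2 Q3 Q3' irr'.
Proof.
move=> PQ PQ1 PQ2 PQ3 PQ3' ii' [W [W1 [W2 [W3 [[WP W1P W2P W3P W3P'] [dec2 dec1 d1 d2 d3]]]]]].
exists W, W1, W2, W3; split; split=> //.
- by move=> S; exact: iff_trans (WP S) (PQ S).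
- by move=> S; exact: iff_trans (W1P S) (PQ1 S).
- by move=> e we S; exact: iff_trans (W2P e we S) (PQ2 e S).
- by move=> S; exact: iff_trans (W3P S) (PQ3 S).
- by move=> S; exact: iff_trans (W3P' S) (PQ3' S).
- by move=> /dec2[? ? i1 i2 i3]; split=> //; exact: ii'.
- by move=> /dec1[? ? i1 i3]; split=> //; exact: ii'.
Qed.

Lemma tensor_space_decomposition (R : realType) (V : vectType R) (n : nat)
    (w : {skew_symmetric V}) : \dim {:V} = (2 * n)%N -> is_psymplectic w ->
  decomposition w (@sym12 R V) (fun S => exists U, S = vec_tensor w U)
    (fun e : (n + n).-tuple V => S2_tensor (tnth e) (dual_basis e)) (@sym_tensor R V)
    (@sym_tensor R V) (irreducible w).
Proof.
move=> dimV w_sympl; have [e we] := symplectic_basis_exists dimV w_sympl.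
have ed := dual_pair_dual_basis we; have w_ed := w_dual_basis we.
have [W WP] := sym12_vspace V.
have [W1 W1P] := vec_tensor_vspace w.
have [W2 W2P] := S2_tensor_vspace (tnth e) (dual_basis e).
have [W3 W3P] := sym_tensor_vspace V.
have dimW : \dim W = ('C((n + n).+1, 2) * (n + n))%N := dim_sym12 ed w_ed WP.
have dimW1 : \dim W1 = (n + n)%N := dim_S1 ed w_ed W1P.
have dimW3 : \dim W3 = 'C((n + n).+2, 3) := dim_S3 ed w_ed W3P.
have [W_sum W_dir] : W = (W1 + W2 + W3)%VS /\ directv (W1 + W2 + W3).
  apply: directv3.
  - apply/subvP => S /W1P[U ->]; apply/WP => X Y Z.
    by rewrite !vec_tensorE addrC.
  - by apply/subvP => S /W2P[s12 _ _]; apply/WP.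
  - by apply/subvP => S /W3P[s12 _]; apply/WP.
  - move=> S /WP/(tensor_decomposition ed w_ed)[S1 [S2 [S3 [S1P S2P S3P SE]]]].
    exists S1, S2, S3; split; [exact/W1P | exact/W2P | exact/W3P |].
    by apply/triP => X Y Z; rewrite !tri_add.
  - move=> S1 S2 S3 /W1P S1P /W2P S2P /W3P S3P S0.
    apply: (tensor_independent ed w_ed S1P S2P S3P) => X Y Z.
    by rewrite -!tri_add S0 tri_zero.
have dim_sum : \dim W = (\dim W1 + \dim W2 + \dim W3)%N.
  by rewrite W_sum (directvP W_dir).
have dimW2 : (\dim W2)%:R = 8 / 3 * (n%:R ^+ 3 - n%:R) :> R.
  by apply: dim_S2_arith; rewrite -dimW dim_sum dimW1 dimW3.
have nz1 : (0 < n)%N -> W1 <> 0%VS.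
  by move=> n0 W0; move: dimW1; rewrite W0 dimv0; lia.
have nz3 : (0 < n)%N -> W3 <> 0%VS.
  move=> n0 W0; move: dimW3; rewrite W0 dimv0 => /esym/eqP.
  by rewrite -leqn0 leqNgt bin_gt0; lia.
have irr1 : (0 < n)%N -> irreducible w W1 by move/nz1; exact: irreducible_S1 ed W1 W1P.
have irr3 : (0 < n)%N -> irreducible w W3 by move/nz3; exact: irreducible_S3 ed W3 W3P.
exists W, W1, W2, W3; split; split=> //.
- move=> e' we' S; apply: iff_trans (W2P S) _.
  exact: S2_tensor_basis ed (dual_pair_dual_basis we') S.
- move=> n2; have n0 : (0 < n)%N by exact: ltnW.
  split=> //; [exact: irr1 | | exact: irr3].
  apply: (irreducible_S2 ed w_ed W2P) => W20.
  have n2R : 2 <= n%:R :> R by rewrite ler_nat.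
  (* This product is n^3 - n, so the dimension formula excludes W2 = 0. *)
  have : 0 < (n%:R - 1) * (n%:R * (n%:R + 1)) :> R by rewrite !mulr_gt0 //; lra.
  by move: dimW2; rewrite W20 dimv0; lra.
- move=> n1; have n0 : (0 < n)%N by rewrite n1.
  (* For n = 1 the dimension formula gives 0, so S_2 drops out of the sum. *)
  have W20 : W2 = 0%VS.
    by apply/eqP; rewrite -dimv_eq0 -(pnatr_eq0 R) dimW2 n1 expr1n subrr mulr0.
  have W13 : W = (W1 + W3)%VS by rewrite W_sum W20 addv0.
  split=> //; [|exact: irr1 | exact: irr3].
  by apply/directvP; rewrite /= -W13 dim_sum W20 dimv0 addn0.
- by rewrite dimW1; lia.
- by rewrite dimW3; congr 'C(_, _); lia.
Qed.

(* The identity c is there because [irreducible_Sp_submodule] quantifies over elements of the raw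
   ['Hom] type, which is only convertible to the carrier of T. *)
Definition irreducible_under (F : fieldType) (T : vectType F) (H G : Type) (c : H -> T)
    (ok : G -> Prop) (a : G -> H -> H) (W : {vspace T}) :=
  let inv (U : {vspace T}) := forall g S, ok g -> c S \in U -> c (a g S) \in U in
  [/\ inv W, W <> 0%VS & forall U, inv U -> (U <= W)%VS -> U = 0%VS \/ U = W].

Lemma irreducible_under_Sp (R : realType) (V : vectType R) (w : {skew_symmetric V})
    (W : {vspace trilinear R V}) :
  irreducible_under (fun S : trilinear R V => S) (Sp w) (@tensor_act R V) W ->
  irreducible_Sp_submodule w W.
Proof.
rewrite /irreducible_under /irreducible_Sp_submodule /Sp_submodule /=.
exact.
Qed.

Lemma in_S1_vec_tensor (R : realType) (V : vectType R) (w : {skew_symmetric V})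
    (S : tensor V) :
  (exists U, S = vec_tensor w U) <-> in_S1 w S.
Proof.
split=> [[U ->]|H]; last first.
  by case: H => _ [U SU]; exists U; apply/triP => X Y Z; rewrite vec_tensorE; exact: SU.
have s12 : sym12 (vec_tensor w U) by move=> X Y Z; rewrite !vec_tensorE addrC.
by refine (conj s12 _); exists U; exact: vec_tensorE.
Qed.

Lemma in_S2_S2_tensor (R : realType) (V : vectType R) (n : nat)
    (e : (n + n).-tuple V) (S : tensor V) :
  S2_tensor (tnth e) (dual_basis e) S <-> in_S2 e S.
Proof.
split=> H.
  case: H => s12 cyc tr; refine (And3 s12 cyc _) => Z.
  exact: etrans (s13_trace e S Z) (tr Z).
case: H => s12 cyc tr; refine (And3 s12 cyc _) => Z.
exact: etrans (esym (s13_trace e S Z)) (tr Z).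
Qed.

Theorem theorem5p1 (R : realType) (V : vectType R) (n : nat)
    (w : {skew_symmetric V})
    (dimV : \dim {:V} = (2 * n)%N) (w_sympl : is_psymplectic w) :
  exists W W1 W2 W3 : {vspace trilinear R V},
  [/\ forall S, S \in W <-> cotorsion_like S,
      forall S, S \in W1 <-> in_S1 w S,
      forall e : (n + n).-tuple V, symplectic_basis w e ->
        forall S, S \in W2 <-> in_S2 e S,
      forall S, S \in W3 <-> in_S3 S
    & forall S, S \in W3 <-> totally_symmetric S] /\
  [/\ (2 <= n)%N ->
        [/\ W = (W1 + W2 + W3)%VS, directv (W1 + W2 + W3),
            irreducible_Sp_submodule w W1, irreducible_Sp_submodule w W2
          & irreducible_Sp_submodule w W3],
      n = 1%N ->
        [/\ W = (W1 + W3)%VS, directv (W1 + W3),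
            irreducible_Sp_submodule w W1 & irreducible_Sp_submodule w W3],
      \dim W1 = (2 * n)%N,
      (\dim W2)%:R = 8 / 3 * (n%:R ^+ 3 - n%:R) :> R
    & \dim W3 = 'C(2 * n + 2, 3)].
Proof.
(* Three stages: the predicates are replaced over [tensor V], then the carrier becomes the
   convertible iterated ['Hom], and last the form of irreducibility is changed. *)
have tensor_side : @decomposition R V n w R (tensor V) (@cotorsion_like R V) (in_S1 w)
    (@in_S2 R V n) (@in_S3 R V) (@totally_symmetric R V)
    (irreducible_under (fun S : trilinear R V => S : tensor V) (Sp w) (@tensor_act R V)).
  apply: decomposition_mono (tensor_space_decomposition dimV w_sympl) => //.
  - exact: in_S1_vec_tensor.
  - exact: in_S2_S2_tensor.
  - exact: in_S3_totally_symmetric.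
have hom_side : @decomposition R V n w R (trilinear R V) (@cotorsion_like R V) (in_S1 w)
    (@in_S2 R V n) (@in_S3 R V) (@totally_symmetric R V)
    (irreducible_under (fun S : trilinear R V => S) (Sp w) (@tensor_act R V)).
  exact: tensor_side.
have : @decomposition R V n w R (trilinear R V) (@cotorsion_like R V) (in_S1 w)
    (@in_S2 R V n) (@in_S3 R V) (@totally_symmetric R V) (irreducible_Sp_submodule w).
  refine (decomposition_mono _ _ _ _ _ _ hom_side).
  - by move=> S; exact: iff_refl.
  - by move=> S; exact: iff_refl.
  - by move=> e S; exact: iff_refl.
  - by move=> S; exact: iff_refl.
  - by move=> S; exact: iff_refl.
  - exact: irreducible_under_Sp.
exact.
Qed.
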